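(* Let $U$, $V$ and $W$ be absolute matrix order unit spaces and let $\phi:U\to V$ and $\psi:V\to W$ be unital completely $|\cdot|$-preserving maps. Then (a) $K(I_V)=I_{K(V)}$, where $I_V$ and $I_{K(V)}$ are the identity maps of $V$ and of $K(V)$; (b) $K(\psi\circ\phi)=K(\psi)\circ K(\phi)$; (c) $K(0_{W,V})=0_{K(W),K(V)}$, where $0_{W,V}:V\to W$ is the zero map and $0_{K(W),K(V)}:K(V)\to K(W)$ is the zero group homomorphism.
   Context: Matrices. For a complex $*$-vector space $V$ (complex vector space with a conjugate-linear involution $*$), $M_{m,n}(V)$ denotes the $m\times n$ matrices over $V$, $M_n(V)=M_{n,n}(V)$, $M_{m,n}=M_{m,n}(\mathbb{C})$, $M_n=M_{n,n}$; products $\alpha v$, $v\beta$ with scalar matrices are the usual ones, $[v_{i,j}]^*=[v_{j,i}^*]$, $M_n(V)_{sa}=\{v\in M_n(V):v=v^*\}$, $v\oplus w=\begin{bmatrix}v&0\\0&w\end{bmatrix}$, and $0_n$ is the zero of $M_n(V)$. A matrix ordered space is a $*$-vector space $V$ with sets $M_n(V)^+\subset M_n(V)_{sa}$ ($n\in\mathbb{N}$) such that each $(M_n(V)_{sa},M_n(V)^+)$ is a real ordered vector space ($M_n(V)^+$ is a cone: closed under sums and nonnegative scalar multiples; $u\le v$ means $v-u\in M_n(V)^+$) and $\alpha^*v\alpha\in M_m(V)^+$ for all $v\in M_n(V)^+$, $\alpha\in M_{n,m}$. Write $V^+=M_1(V)^+$. An absolutely ordered space is a real ordered vector space $(X,X^+)$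 with a map $|\cdot|:X\to X^+$ such that: (1) $|x|=x$ for $x\in X^+$; (2) $|x|\pm x\in X^+$ for $x\in X$; (3) $|kx|=|k||x|$ for $k\in\mathbb{R}$; (4) if $|x-y|=x+y$ and $0\le z\le y$, then $|x-z|=x+z$; (5) if $|x-y|=x+y$ and $|x-z|=x+z$, then $\big|x-|y\pm z|\big|=x+|y\pm z|$. An absolutely matrix ordered space is a matrix ordered space with maps $|\cdot|_{m,n}:M_{m,n}(V)\to M_n(V)^+$ (write $|\cdot|_n=|\cdot|_{n,n}$) such that: each $(M_n(V)_{sa},M_n(V)^+,|\cdot|_n)$ is an absolutely ordered space; $|\alpha v\beta|_{r,s}\le\|\alpha\|\,\big||v|_{m,n}\beta\big|_{n,s}$ for $v\in M_{m,n}(V)$, $\alpha\in M_{r,m}$, $\beta\in M_{n,s}$; and $|v\oplus w|_{m+r,n+s}=|v|_{m,n}\oplus|w|_{r,s}$ for $v\in M_{m,n}(V)$, $w\in M_{r,s}(V)$. For $u,v\in M_n(V)^+$, $u\perp v$ means $|u-v|_n=u+v$. A matrix order unit space $(V,e)$ is a matrix ordered space with an order unit $e\in V^+$ for $V_{sa}$ (every $v\in V_{sa}$ satisfies $ke\pm v\in V^+$ for some $k>0$), with $V^+$ proper ($V^+\cap(-V^+)=\{0\}$) and every $M_n(V)^+$ Archimedean (if $v\in M_n(V)_{sa}$ and $ku+v\in M_n(V)^+$ for a fixed $u\in M_n(V)^+$ and all $k>0$, then $v\in M_n(V)^+$). Put $e^n=e\oplus\cdots\oplus e\in M_n(V)$.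 It carries the norms $\|v\|_n=\inf\{k>0:\begin{bmatrix}ke^n&v\\ v^*&ke^n\end{bmatrix}\in M_{2n}(V)^+\}$ on $M_n(V)$; continuity is with respect to these norms. For $u,v\in M_n(V)^+$, $u\perp_\infty v$ means $\|u+kv\|_n=\max\{\|u\|_n,\|kv\|_n\}$ for all $k\in\mathbb{R}$, and $u\perp_\infty^a v$ means $u_1\perp_\infty v_1$ whenever $0\le u_1\le u$ and $0\le v_1\le v$. An absolute matrix order unit space is a matrix order unit space $(V,e)$ that is also an absolutely matrix ordered space and for which $\perp=\perp_\infty^a$ on $M_n(V)^+$ for every $n$. Partial unitaries and $K$. $p\in M_n(V)$ is an order projection if $p^*=p$ and $|2p-e^n|_n=e^n$. $u\in M_n(V)$ is a partial unitary if $|u|_n=|u^*|_n$ and this element is an order projection; $\mathcal{PU}_n(V)$ is the set of partial unitaries in $M_n(V)$ and $\mathcal{PU}_\infty(V)=\bigcup_{n=1}^\infty\mathcal{PU}_n(V)$ (each element is a matrix of a definite size). For $u,v\in\mathcal{PU}_n(V)$, $u\sim_h v$ means there is a continuous $f:[0,1]\to\mathcal{PU}_n(V)$ with $f(0)=u$, $f(1)=v$. For $u\in\mathcal{PU}_m(V)$, $v\in\mathcal{PU}_n(V)$, $u\sim_K v$ means there is $k>\max\{m,n\}$ with $u\oplus 0_{k-m}\sim_h v\oplus 0_{k-n}$ in $\mathcal{PU}_k(V)$. For $u,v\in\mathcal{PU}_\infty(V)$, $u\approx_K v$ means there is $w\in\mathcal{PU}_\infty(V)$ with $u\oplus w\sim_K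 v\oplus w$. On $\mathcal{PU}_\infty(V)\times\mathcal{PU}_\infty(V)$ the equivalence relation $(u_1,v_1)\equiv_K(u_2,v_2)\iff u_1\oplus v_2\approx_K u_2\oplus v_1$ has classes $[(u,v)]$; $K(V)$ is the set of these classes, an abelian group under $[(u_1,v_1)]+[(u_2,v_2)]=[(u_1\oplus u_2,v_1\oplus v_2)]$. Morphisms. For a linear map $\phi:V\to W$, $\phi_n:M_n(V)\to M_n(W)$ is the entrywise application of $\phi$, also written $\phi$. A $*$-linear map $\phi$ between absolute matrix order unit spaces is completely $|\cdot|$-preserving if $|\phi_n(v)|_n=\phi_n(|v|_n)$ for all $v\in M_n(V)$ and $n\in\mathbb{N}$, and unital if it maps order unit to order unit. For $\phi:V\to W$ unital completely $|\cdot|$-preserving, $K(\phi):K(V)\to K(W)$ is the unique group homomorphism with $K(\phi)([(v,0)])=[(\phi(v),0)]$ for all $v\in\mathcal{PU}_\infty(V)$; it is given by $K(\phi)([(v,w)])=[(\phi(v),\phi(w))]$. For the (non-unital) zero map $0_{W,V}$, $K(0_{W,V})$ is defined by the same formula. *)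

(* Defs.v *)
From HB Require Import structures.
From mathcomp Require Import all_boot all_order all_algebra.
From mathcomp Require Import complex.
From mathcomp Require Import all_classical all_reals all_analysis.
Set Implicit Arguments.
Unset Strict Implicit.
Unset Printing Implicit Defensive.
Import Order.TTheory GRing.Theory Num.Theory.
Import numFieldNormedType.Exports.
Local Open Scope classical_set_scope.
Local Open Scope ring_scope.
Local Open Scope complex_scope.

(* Scalars: R is a model of the real numbers and R[i] of the complex numbers.
   Matrices of size 0 are allowed in all the axioms below; since M_0(V) = 0
   this only fixes the trivial values of the structure there.  Partial
   unitaries, from which K(V) is built, are required to have positive size. *)

Definition adjmx (R : realType) m n (a : 'M[R[i]]_(m, n)) : 'M[R[i]]_(n, m) :=
  (map_mx conjc a)^T.

Definition l2norm (R : realType) n (x : 'cV[R[i]]_n) : R :=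
  Num.sqrt (\sum_i Normc.normc (x i 0) ^+ 2).

Definition opnorm (R : realType) m n (a : 'M[R[i]]_(m, n)) : R :=
  sup [set l2norm (a *m x) | x in [set x : 'cV[R[i]]_n | l2norm x <= 1]].

HB.mixin Record hasStar (R : realType) V of GRing.Lmodule R[i] V := {
  vstar : V -> V;
  vstarD : {morph vstar : x y / x + y};
  vstarZ : forall (c : R[i]) (x : V), vstar (c *: x) = conjc c *: vstar x;
  vstarK : involutive vstar
}.

#[short(type="starVectType")]
HB.structure Definition StarVect (R : realType) :=
  {V of GRing.Lmodule R[i] V & hasStar R V}.

Section MatricesOverV.
Variables (R : realType) (V : starVectType R).

Definition lmulV m n p (a : 'M[R[i]]_(m, n)) (v : 'M[V]_(n, p)) : 'M[V]_(m, p) :=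
  \matrix_(i, j) \sum_k a i k *: v k j.

Definition rmulV m n p (v : 'M[V]_(m, n)) (b : 'M[R[i]]_(n, p)) : 'M[V]_(m, p) :=
  \matrix_(i, j) \sum_k b k j *: v i k.

Definition rscaleV m n (k : R) (v : 'M[V]_(m, n)) : 'M[V]_(m, n) :=
  map_mx (fun x => k%:C *: x) v.

Definition starmx m n (v : 'M[V]_(m, n)) : 'M[V]_(n, m) := (map_mx vstar v)^T.

Definition samx n : set 'M[V]_n := [set v | starmx v = v].

Definition dsum m n r s (v : 'M[V]_(m, n)) (w : 'M[V]_(r, s)) :
  'M[V]_(m + r, n + s) := block_mx v 0 0 w.

End MatricesOverV.

HB.mixin Record isMatrixOrdered (R : realType) V of StarVect R V := {
  mxpos : forall n, set 'M[V]_n;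
  mxpos_sa : forall n, mxpos n `<=` @samx R V n;
  mxpos0 : forall n, mxpos n 0;
  mxposD : forall n (u v : 'M[V]_n), mxpos n u -> mxpos n v -> mxpos n (u + v);
  mxposZ : forall n (k : R) (u : 'M[V]_n),
    0 <= k -> mxpos n u -> mxpos n (@rscaleV R V n n k u);
  mxposJ : forall n m (a : 'M[R[i]]_(n, m)) (v : 'M[V]_n),
    mxpos n v -> mxpos m (@rmulV R V _ _ _ (@lmulV R V _ _ _ (adjmx a) v) a)
}.

#[short(type="matrixOrderedType")]
HB.structure Definition MatrixOrdered (R : realType) :=
  {V of StarVect R V & isMatrixOrdered R V}.

Arguments mxpos {R s} n.

(* The real ordered vector space is (X, P), where X is given as a real
   subspace of the ambient type T, so that abs only matters on X. *)
Record absolutely_ordered (R : realType) (T : zmodType) (scale : R -> T -> T)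
    (X P : set T) (abs : T -> T) : Prop := {
  abso_pos : forall x, X x -> P (abs x);
  abso_id : forall x, P x -> abs x = x;
  abso_le : forall x, X x -> P (abs x + x) /\ P (abs x - x);
  abso_scale : forall (k : R) x, X x -> abs (scale k x) = scale `|k| (abs x);
  abso_orth_le : forall x y z, X x -> X y -> X z ->
    abs (x - y) = x + y -> P z -> P (y - z) -> abs (x - z) = x + z;
  abso_orth_abs : forall x y z, X x -> X y -> X z ->
    abs (x - y) = x + y -> abs (x - z) = x + z ->
    abs (x - abs (y + z)) = x + abs (y + z) /\
    abs (x - abs (y - z)) = x + abs (y - z)
}.

HB.mixin Record isAbsMatrixOrdered (R : realType) V of MatrixOrdered R V := {
  mxabs : forall m n, 'M[V]_(m, n) -> 'M[V]_n;
  mxabs_pos : forall m n (v : 'M[V]_(m, n)), @mxpos R V n (mxabs m n v);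
  mxabs_abso : forall n,
    absolutely_ordered (@rscaleV R V n n) (@samx R V n) (@mxpos R V n) (mxabs n n);
  mxabsM : forall m n r s (a : 'M[R[i]]_(r, m)) (v : 'M[V]_(m, n))
      (b : 'M[R[i]]_(n, s)),
    @mxpos R V s
      (@rscaleV R V _ _ (opnorm a)
         (mxabs n s (@rmulV R V _ _ _ (mxabs m n v) b))
       - mxabs r s (@rmulV R V _ _ _ (@lmulV R V _ _ _ a v) b));
  mxabs_dsum : forall m n r s (v : 'M[V]_(m, n)) (w : 'M[V]_(r, s)),
    mxabs (m + r)%N (n + s)%N (@dsum R V _ _ _ _ v w) =
      @dsum R V _ _ _ _ (mxabs m n v) (mxabs r s w)
}.

#[short(type="absMatrixOrderedType")]
HB.structure Definition AbsMatrixOrdered (R : realType) :=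
  {V of MatrixOrdered R V & isAbsMatrixOrdered R V}.

Arguments mxabs {R s m n} v : rename.

(* V is identified with 'M[V]_1 through const_mx; V_sa and V^+ are read there.
   The amplified unit e^n is the scalar matrix e%:M. *)
HB.mixin Record isMatrixOrderUnit (R : realType) V of MatrixOrdered R V := {
  ounit : V;
  ounit_pos : @mxpos R V 1%N (const_mx ounit);
  ounitP : forall v : 'M[V]_1, @samx R V 1%N v -> exists2 k : R, 0 < k &
    @mxpos R V 1%N (@rscaleV R V _ _ k (const_mx ounit) + v) /\
    @mxpos R V 1%N (@rscaleV R V _ _ k (const_mx ounit) - v);
  mxpos_proper : forall v : 'M[V]_1,
    @mxpos R V 1%N v -> @mxpos R V 1%N (- v) -> v = 0;
  mxpos_archimedean : forall n (u v : 'M[V]_n),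
    @mxpos R V n u -> @samx R V n v ->
    (forall k : R, 0 < k -> @mxpos R V n (@rscaleV R V _ _ k u + v)) ->
    @mxpos R V n v
}.

#[short(type="matrixOrderUnitType")]
HB.structure Definition MatrixOrderUnit (R : realType) :=
  {V of MatrixOrdered R V & isMatrixOrderUnit R V}.

Arguments ounit {R s}.

Section MatrixNorm.
Variables (R : realType) (V : matrixOrderUnitType R).

Definition mxnorm n (v : 'M[V]_n) : R :=
  inf [set k : R | 0 < k /\
    mxpos (n + n)%N (block_mx (rscaleV k (ounit%:M)) v
                              (starmx v) (rscaleV k (ounit%:M)))].

Definition orth_inf n (u v : 'M[V]_n) : Prop :=
  forall k : R, mxnorm (u + rscaleV k v) = Num.max (mxnorm u) (mxnorm (rscaleV k v)).

Definition orth_inf_a n (u v : 'M[V]_n) : Prop :=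
  forall u1 v1 : 'M[V]_n,
    mxpos n u1 -> mxpos n (u - u1) -> mxpos n v1 -> mxpos n (v - v1) ->
    orth_inf u1 v1.

End MatrixNorm.

Definition orth (R : realType) (V : absMatrixOrderedType R) n (u v : 'M[V]_n) :
  Prop := mxabs (u - v) = u + v.

#[short(type="preAbsMatrixOrderUnitType")]
HB.structure Definition PreAbsMatrixOrderUnit (R : realType) :=
  {V of AbsMatrixOrdered R V & MatrixOrderUnit R V}.

HB.mixin Record isAbsMatrixOrderUnit (R : realType) V
    of PreAbsMatrixOrderUnit R V := {
  orth_orth_inf_a : forall n (u v : 'M[V]_n),
    @mxpos R V n u -> @mxpos R V n v ->
    (@orth R V n u v <-> @orth_inf_a R V n u v)
}.

#[short(type="absMatrixOrderUnitType")]
HB.structure Definition AbsMatrixOrderUnit (R : realType) :=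
  {V of PreAbsMatrixOrderUnit R V & isAbsMatrixOrderUnit R V}.

Section PartialUnitaries.
Variables (R : realType) (V : absMatrixOrderUnitType R).

Definition order_projection n (p : 'M[V]_n) : Prop :=
  starmx p = p /\ mxabs (p *+ 2 - ounit%:M) = ounit%:M.

Definition partial_unitary n (u : 'M[V]_n) : Prop :=
  mxabs u = mxabs (starmx u) /\ order_projection (mxabs u).

(* u ~_h v: continuity of f : [0, 1] -> PU_n(V) is for the norm of M_n(V). *)
Definition homotopic n (u v : 'M[V]_n) : Prop :=
  exists f : R -> 'M[V]_n,
    [/\ forall t, t \in `[0, 1] -> partial_unitary (f t),
        forall t, t \in `[0, 1] ->
          mxnorm (f s - f t) @[s --> within `[0, 1] (nbhs t)] --> (0 : R),
        f 0 = u & f 1 = v].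

(* u (+) 0_{k-m}, to be used for m <= k; conform_mx only casts the size
   m + (k - m) to k. *)
Definition padmx k m (u : 'M[V]_m) : 'M[V]_k :=
  conform_mx 0 (dsum u (0 : 'M[V]_(k - m))).

Record PUinf := MkPU {
  pu_size : nat;
  pu_mx :> 'M[V]_pu_size;
  pu_size_gt0 : (0 < pu_size)%N;
  pu_mxP : partial_unitary pu_mx
}.

End PartialUnitaries.

Arguments padmx {R V} k {m} u.

Section Facts.
Variables (R : realType) (V : absMatrixOrderUnitType R).

Lemma vstar0 : vstar (0 : V) = 0.
Proof. by have := vstarD (0 : V) 0; rewrite addr0 -[LHS]addr0 => /addrI. Qed.

Lemma starmx0 m n : starmx (0 : 'M[V]_(m, n)) = 0.
Proof. by apply/matrixP=> i j; rewrite !mxE vstar0. Qed.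

Lemma starmx_dsum m n r s (v : 'M[V]_(m, n)) (w : 'M[V]_(r, s)) :
  starmx (dsum v w) = dsum (starmx v) (starmx w).
Proof.
rewrite /starmx /dsum map_block_mx tr_block_mx; congr block_mx.
- exact: starmx0.
- exact: starmx0.
Qed.

Lemma rscaleVN1 m n (v : 'M[V]_(m, n)) : rscaleV (-1) v = - v.
Proof. by apply/matrixP=> i j; rewrite !mxE rmorphN rmorph1 scaleN1r. Qed.

Lemma rscaleV1 m n (v : 'M[V]_(m, n)) : rscaleV 1 v = v.
Proof. by apply/matrixP=> i j; rewrite !mxE rmorph1 scale1r. Qed.

Lemma mxabs_id n (v : 'M[V]_n) : mxpos n v -> mxabs v = v.
Proof. exact: (abso_id (mxabs_abso n)). Qed.

Lemma mxabsN n (v : 'M[V]_n) : samx v -> mxabs (- v) = mxabs v.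
Proof.
move=> sv; rewrite -rscaleVN1 (abso_scale (mxabs_abso n)) //.
by rewrite normrN normr1 rscaleV1.
Qed.

Lemma ounitmx_pos n : mxpos n (ounit%:M : 'M[V]_n).
Proof.
have -> : (ounit%:M : 'M[V]_n) = \sum_(l < n)
    rmulV (lmulV (adjmx (delta_mx 0 l : 'M[R[i]]_(1, n)))
                 (const_mx ounit : 'M[V]_1)) (delta_mx 0 l).
  apply/matrixP=> i j; rewrite summxE (bigD1 i) //= big1 ?addr0.
    rewrite !mxE big_ord_recl big_ord0 addr0 !mxE big_ord_recl big_ord0 addr0.
    rewrite !mxE !eqxx andTb conjc1 scale1r [j == i]eq_sym.
    by case: (i == j); rewrite ?scale1r ?scale0r.
  move=> l /negPf li; rewrite !mxE big_ord_recl big_ord0 addr0 !mxE.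
  rewrite big_ord_recl big_ord0 addr0 !mxE [i == l]eq_sym li andbF.
  by rewrite conjc0 scale0r scaler0.
apply: (big_ind (mxpos n)); [exact: mxpos0|by move=> *; exact: mxposD|].
by move=> l _; apply: mxposJ; exact: ounit_pos.
Qed.

Lemma partial_unitary0 n : partial_unitary (0 : 'M[V]_n).
Proof.
have a0 : mxabs (0 : 'M[V]_n) = 0 by apply: mxabs_id; exact: mxpos0.
split; first by rewrite starmx0.
rewrite a0; split; first exact: starmx0.
rewrite mul0rn sub0r mxabsN; last exact/mxpos_sa/ounitmx_pos.
exact/mxabs_id/ounitmx_pos.
Qed.

Lemma partial_unitary_dsum m n (u : 'M[V]_m) (v : 'M[V]_n) :
  partial_unitary u -> partial_unitary v -> partial_unitary (dsum u v).
Proof.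
move=> [u1 [u2 u3]] [v1 [v2 v3]]; split.
  by rewrite starmx_dsum !mxabs_dsum -u1 -v1.
rewrite mxabs_dsum; split; first by rewrite starmx_dsum u2 v2.
have -> : dsum (mxabs u) (mxabs v) *+ 2 - ounit%:M =
    dsum (mxabs u *+ 2 - ounit%:M) (mxabs v *+ 2 - ounit%:M).
  rewrite /dsum mulr2n add_block_mx addr0 scalar_mx_block opp_block_mx.
  by rewrite add_block_mx !oppr0 !addr0 -!mulr2n.
by rewrite mxabs_dsum u3 v3 [RHS]scalar_mx_block.
Qed.

Definition PU0 : PUinf V := MkPU (ltn0Sn 0) (partial_unitary0 1).

Lemma addn_gt0l m n : (0 < m)%N -> (0 < m + n)%N.
Proof. by rewrite addn_gt0 => ->. Qed.

Definition PUsum (u v : PUinf V) : PUinf V :=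
  MkPU (addn_gt0l (pu_size v) (pu_size_gt0 u))
       (partial_unitary_dsum (pu_mxP u) (pu_mxP v)).

End Facts.

Arguments PU0 {R V}.

Section KGroup.
Variables (R : realType) (V : absMatrixOrderUnitType R).
Implicit Types (u v : PUinf V) (p q : PUinf V * PUinf V).

Definition simK u v : Prop :=
  exists2 k, (maxn (pu_size u) (pu_size v) < k)%N & homotopic (padmx k u) (padmx k v).

Definition approxK u v : Prop := exists w, simK (PUsum u w) (PUsum v w).

Definition equivK p q : Prop := approxK (PUsum p.1 q.2) (PUsum q.1 p.2).

Definition Kclass p : set (PUinf V * PUinf V) := [set q | equivK p q].

Definition K : Type := set_type (range Kclass).

Lemma Kclass_in p : Kclass p \in range Kclass.
Proof. by apply/mem_set; exists p. Qed.

Definition Kcl p : K := exist _ (Kclass p) (Kclass_in p).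

Lemma Kcl_surj (x : K) : exists p, Kcl p = x.
Proof.
by case: x => A hA; have [p _ pA] := set_mem hA; exists p; apply: val_inj.
Qed.

Definition Krepr (x : K) : PUinf V * PUinf V := projT1 (cid (Kcl_surj x)).

Definition Kadd (x y : K) : K :=
  Kcl (PUsum (Krepr x).1 (Krepr y).1, PUsum (Krepr x).2 (Krepr y).2).

(* The neutral element of Kadd: it is [(u, u)] for every u. *)
Definition Kzero : K := Kcl (PU0, PU0).

End KGroup.

Section Morphisms.
Variables (R : realType) (V W : absMatrixOrderUnitType R).

Definition completely_abs_preserving (phi : {linear V -> W}) : Prop :=
  (forall x, phi (vstar x) = vstar (phi x)) /\
  (forall n (v : 'M[V]_n), mxabs (map_mx phi v) = map_mx phi (mxabs v)).

Definition unital (phi : {linear V -> W}) : Prop := phi ounit = ounit.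

(* phi on PU_oo(V).  The second branch is never used for a unital completely
   |.|-preserving map, nor for the zero map: see the lemmas below. *)
Definition PUmap (phi : V -> W) (u : PUinf V) : PUinf W :=
  match pselect (partial_unitary (map_mx phi u)) with
  | left hu => MkPU (pu_size_gt0 u) hu
  | right _ => PU0
  end.

Lemma partial_unitary_map (phi : {linear V -> W}) n (u : 'M[V]_n) :
  unital phi -> completely_abs_preserving phi ->
  partial_unitary u -> partial_unitary (map_mx phi u).
Proof.
move=> phi1 [phis phia] [u1 [u2 u3]].
have st k (v : 'M[V]_k) : starmx (map_mx phi v) = map_mx phi (starmx v).
  by apply/matrixP=> i j; rewrite !mxE phis.
split; first by rewrite st !phia u1.
rewrite phia; split; first by rewrite st u2.
have e1 : (ounit%:M : 'M[W]_n) = map_mx phi (ounit%:M : 'M[V]_n).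
  by apply/matrixP=> i j; rewrite !mxE raddfMn /= (phi1 : phi ounit = ounit).
by rewrite e1 -raddfMn -raddfB phia u3.
Qed.

Lemma PUmap_unitalE (phi : {linear V -> W}) (u : PUinf V)
    (phi1 : unital phi) (phia : completely_abs_preserving phi) :
  PUmap phi u = MkPU (pu_size_gt0 u) (partial_unitary_map phi1 phia (pu_mxP u)).
Proof.
rewrite /PUmap; case: pselect => [h|[]]; last exact/partial_unitary_map/pu_mxP.
by congr MkPU; exact: Prop_irrelevance.
Qed.

Lemma partial_unitary_map0 n (u : 'M[V]_n) :
  partial_unitary (map_mx (fun _ : V => 0 : W) u).
Proof.
have -> : map_mx (fun _ : V => 0 : W) u = 0 by apply/matrixP=> i j; rewrite !mxE.
exact: partial_unitary0.
Qed.

Lemma PUmap_zeroE (u : PUinf V) : PUmap (fun _ : V => 0 : W) u =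
  MkPU (pu_size_gt0 u) (partial_unitary_map0 u).
Proof.
rewrite /PUmap; case: pselect => [h|[]]; last exact: partial_unitary_map0.
by congr MkPU; exact: Prop_irrelevance.
Qed.

(* h is a group homomorphism with h [(v, w)] = [(phi v, phi w)]; for w = 0 the
   formula reads h [(v, 0)] = [(phi v, 0)].  As every element of K(V) is some
   [(v, w)], there is at most one such h. *)
Definition is_Kmap (phi : V -> W) (h : K V -> K W) : Prop :=
  {morph h : x y / Kadd x y} /\
  forall v w : PUinf V, h (Kcl (v, w)) = Kcl (PUmap phi v, PUmap phi w).

Definition Kmap (phi : V -> W) : K V -> K W :=
  match pselect (exists h, is_Kmap phi h) with
  | left ex => projT1 (cid ex)
  | right _ => fun=> Kzero W
  end.

Lemma is_Kmap_unique (phi : V -> W) (h1 h2 : K V -> K W) :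
  is_Kmap phi h1 -> is_Kmap phi h2 -> h1 = h2.
Proof.
move=> [_ E1] [_ E2]; apply/funext=> x.
by have [[v w] <-] := Kcl_surj x; rewrite E1 E2.
Qed.

Lemma KmapP (phi : V -> W) (h : K V -> K W) : is_Kmap phi h -> Kmap phi = h.
Proof.
move=> hK; rewrite /Kmap; case: pselect => [ex|[]]; last by exists h.
by apply: is_Kmap_unique hK; exact: projT2 (cid ex).
Qed.

End Morphisms.

(* Main.v *)
Require Import Defs.
From mathcomp Require Import all_boot all_order all_algebra.
From mathcomp Require Import complex.
From mathcomp Require Import all_classical all_reals all_analysis.
From mathcomp Require Import zify lra.
Import Order.TTheory GRing.Theory Num.Theory.
Import numFieldNormedType.Exports.
Local Open Scope classical_set_scope.
Local Open Scope ring_scope.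
Local Open Scope complex_scope.

(* A scalar coisometry a (a a^* = 1) sends a partial unitary u to the partial
   unitary a^* u a: unitaries satisfy |a^* u a| = a^* |u| a because
   multiplication by a contraction does not increase |.|, and a coisometry is
   a corner of a unitary.  If a b^* = 0, then cos t a + sin t b is a path of
   coisometries, so a^* u a and b^* u b are homotopic.  Hence, after enough zero
   padding, the homotopy class of a^* u a does not depend on a, and ~_K holds
   iff a^* u a ~_h b^* v b for some coisometries a, b.  In this form ~_K is
   visibly an equivalence relation for which (+) is commutative and associative,
   so that K(V) is the Grothendieck group of a commutative semigroup, and a
   unital completely |.|-preserving map, being completely positive and therefore
   contractive, preserves ~_K.  Existence of K(phi) follows, and the three
   claims can be read off from the formula for K(phi). *)

Set Implicit Arguments.
Unset Strict Implicit.
Unset Printing Implicit Defensive.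

(** * Adjoints, coisometries and operator norm of scalar matrices *)

Section ScalarMatrices.
Variable R : realType.
Implicit Types m n p : nat.

Lemma adjmxM m n p (a : 'M[R[i]]_(m, n)) (b : 'M[R[i]]_(n, p)) :
  adjmx (a *m b) = adjmx b *m adjmx a.
Proof. by rewrite /adjmx map_mxM trmx_mul. Qed.

Lemma adjmxD m n (a b : 'M[R[i]]_(m, n)) : adjmx (a + b) = adjmx a + adjmx b.
Proof. by rewrite /adjmx map_mxD linearD. Qed.

Lemma adjmxN m n (a : 'M[R[i]]_(m, n)) : adjmx (- a) = - adjmx a.
Proof. by rewrite /adjmx map_mxN linearN. Qed.

Lemma adjmxZ m n c (a : 'M[R[i]]_(m, n)) : adjmx (c *: a) = conjc c *: adjmx a.
Proof. by rewrite /adjmx map_mxZ linearZ. Qed.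

Lemma adjmxK m n (a : 'M[R[i]]_(m, n)) : adjmx (adjmx a) = a.
Proof. by apply/matrixP=> i j; rewrite !mxE conjcK. Qed.

Lemma adjmx0 m n : adjmx (0 : 'M[R[i]]_(m, n)) = 0.
Proof. by apply/matrixP=> i j; rewrite !mxE conjc0. Qed.

Lemma adjmx_scalar n (c : R[i]) : adjmx (c%:M : 'M[_]_n) = (conjc c)%:M.
Proof. by rewrite /adjmx map_scalar_mx tr_scalar_mx. Qed.

Lemma adjmx1 n : adjmx (1%:M : 'M[R[i]]_n) = 1%:M.
Proof. by rewrite adjmx_scalar conjc1. Qed.

Lemma adjmx_row m n p (a : 'M[R[i]]_(m, n)) (b : 'M[R[i]]_(m, p)) :
  adjmx (row_mx a b) = col_mx (adjmx a) (adjmx b).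
Proof. by rewrite /adjmx map_row_mx tr_row_mx. Qed.

Lemma adjmx_block m n r s (a : 'M[R[i]]_(m, n)) (b : 'M[_]_(m, s))
    (c : 'M[_]_(r, n)) (d : 'M[_]_(r, s)) :
  adjmx (block_mx a b c d) =
  block_mx (adjmx a) (adjmx c) (adjmx b) (adjmx d).
Proof. by rewrite /adjmx map_block_mx tr_block_mx. Qed.

Definition coisometry m n (a : 'M[R[i]]_(m, n)) : Prop := a *m adjmx a = 1%:M.

Lemma coisometry1 n : coisometry (1%:M : 'M[R[i]]_n).
Proof. by rewrite /coisometry adjmx1 mulmx1. Qed.

Lemma coisometry_row0 m n p (a : 'M[R[i]]_(m, n)) :
  coisometry a -> coisometry (row_mx a (0 : 'M[_]_(m, p))).
Proof.
by move=> ca; rewrite /coisometry adjmx_row mul_row_col mul0mx addr0.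
Qed.

Lemma coisometry_0row m n p (a : 'M[R[i]]_(m, n)) :
  coisometry a -> coisometry (row_mx (0 : 'M[_]_(m, p)) a).
Proof.
by move=> ca; rewrite /coisometry adjmx_row mul_row_col mul0mx add0r.
Qed.

Lemma coisometry_block m n r s (a : 'M[R[i]]_(m, n)) (b : 'M[_]_(r, s)) :
  coisometry a -> coisometry b -> coisometry (block_mx a 0 0 b).
Proof.
move=> ca cb; rewrite /coisometry adjmx_block mulmx_block !adjmx0.
by rewrite !mul0mx !mulmx0 !addr0 add0r ca cb -scalar_mx_block.
Qed.

Lemma coisometry_scalar n (c : R[i]) :
  c * conjc c = 1 -> coisometry (c%:M : 'M[_]_n).
Proof. by move=> c1; rewrite /coisometry adjmx_scalar -scalar_mxM c1. Qed.

Lemma adjmx_pid m n r : adjmx (pid_mx r : 'M[R[i]]_(m, n)) = pid_mx r.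
Proof.
apply/matrixP=> i j; rewrite !mxE eq_sym.
by case: eqP => [->|_]; rewrite ?andbF ?andFb ?conjc0 //= rmorph_nat.
Qed.

Lemma coisometry_pid m n : (m <= n)%N -> coisometry (pid_mx m : 'M[R[i]]_(m, n)).
Proof.
move=> mn; rewrite /coisometry adjmx_pid mul_pid_mx minnn (minn_idPr mn).
exact: pid_mx_1.
Qed.

Lemma coisometry_delta n (j : 'I_n) :
  coisometry (delta_mx 0 j : 'M[R[i]]_(1, n)).
Proof.
rewrite /coisometry; apply/matrixP=> i k; rewrite !ord1 !mxE (bigD1 j) //=.
rewrite big1 => [|l /negPf lj]; rewrite !mxE ?lj ?mul0r //.
by rewrite !eqxx conjc1 mulr1 addr0.
Qed.

Lemma sqr_l2norm n (x : 'cV[R[i]]_n) : ((l2norm x ^+ 2)%:C = (adjmx x *m x) 0 0).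
Proof.
rewrite /l2norm sqr_sqrtr; last by apply: sumr_ge0 => i _; exact: sqr_ge0.
rewrite mxE raddf_sum; apply: eq_bigr => i _; rewrite !mxE.
by rewrite mulrC -sqr_normc; exact: (rmorphXn (real_complex R) 2).
Qed.

(** An isometry preserves [l2norm], so the supremum runs over numbers at most [1]. Only an
    inequality is claimed: for [n = 0] the supremum is [0]. *)
Lemma opnorm_isometry m n (a : 'M[R[i]]_(m, n)) :
  adjmx a *m a = 1%:M -> opnorm a <= 1.
Proof.
move=> aa; apply: ge_sup.
  (* The set under the supremum must be shown nonempty; the zero vector provides a member. *)
  exists (l2norm (a *m (0 : 'cV_n))), 0 => //=.
  by rewrite /l2norm big1 ?sqrtr0 // => i _; rewrite mxE Normc.normc0 expr0n.
move=> _ [x /= x1 <-]; suff -> : l2norm (a *m x) = l2norm x by [].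
apply/eqP; rewrite -(@eqrXn2 _ 2) ?sqrtr_ge0 //; apply/eqP.
apply: complexI; rewrite !sqr_l2norm adjmxM mulmxA -(mulmxA (adjmx x)).
by rewrite aa mulmx1.
Qed.

End ScalarMatrices.

(** * Two-sided multiplication of matrices over [V] by scalar matrices *)

Section Sandwich.
Variables (R : realType) (V : starVectType R).

Lemma lmulVA m n p q (a : 'M[R[i]]_(m, n)) (b : 'M[_]_(n, p)) (v : 'M[V]_(p, q)) :
  lmulV (a *m b) v = lmulV a (lmulV b v).
Proof.
apply/matrixP=> i j; rewrite !mxE.
under eq_bigr => k _ do rewrite mxE scaler_suml.
rewrite exchange_big /=; apply: eq_bigr => l _.
by rewrite mxE scaler_sumr; apply: eq_bigr => k _; rewrite scalerA.
Qed.

Lemma rmulVA m n p q (v : 'M[V]_(m, n)) (a : 'M[R[i]]_(n, p)) (b : 'M[_]_(p, q)) :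
  rmulV v (a *m b) = rmulV (rmulV v a) b.
Proof.
apply/matrixP=> i j; rewrite !mxE.
under eq_bigr => k _ do rewrite mxE scaler_suml.
rewrite exchange_big /=; apply: eq_bigr => l _.
by rewrite mxE scaler_sumr; apply: eq_bigr => k _; rewrite scalerA mulrC.
Qed.

Lemma lrmulVA m n p q (a : 'M[R[i]]_(m, n)) (v : 'M[V]_(n, p)) (b : 'M[_]_(p, q)) :
  lmulV a (rmulV v b) = rmulV (lmulV a v) b.
Proof.
apply/matrixP=> i j; rewrite !mxE.
under eq_bigr => k _ do rewrite mxE scaler_sumr.
rewrite exchange_big /=; apply: eq_bigr => l _.
rewrite mxE scaler_sumr; apply: eq_bigr => k _.
by rewrite !scalerA mulrC.
Qed.

Lemma lmul1V m n (v : 'M[V]_(m, n)) : lmulV 1%:M v = v.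
Proof.
apply/matrixP=> i j; rewrite !mxE (bigD1 i) //= big1 => [|k /negPf ki].
  by rewrite mxE eqxx scale1r addr0.
by rewrite mxE eq_sym ki scale0r.
Qed.

Lemma rmulV1 m n (v : 'M[V]_(m, n)) : rmulV v 1%:M = v.
Proof.
apply/matrixP=> i j; rewrite !mxE (bigD1 j) //= big1 => [|k /negPf ki].
  by rewrite mxE eqxx scale1r addr0.
by rewrite mxE ki scale0r.
Qed.

(** The two factors are independent so that one-sided multiplication (take [1%:M] on the other side)
    and the off-diagonal blocks of a conjugated block matrix are covered as well. *)
Definition sand m n p q (a : 'M[R[i]]_(m, p)) (b : 'M[R[i]]_(n, q))
  (v : 'M[V]_(m, n)) : 'M[V]_(p, q) := rmulV (lmulV (adjmx a) v) b.

Lemma sandE m n p q (a : 'M[R[i]]_(m, p)) (b : 'M[R[i]]_(n, q))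
    (v : 'M[V]_(m, n)) i j :
  sand a b v i j = \sum_k \sum_l (conjc (a k i) * b l j) *: v k l.
Proof.
rewrite !mxE exchange_big /=; apply: eq_bigr => l _.
rewrite mxE scaler_sumr; apply: eq_bigr => k _.
by rewrite !mxE scalerA mulrC.
Qed.

Lemma sand_sand m n p q r s (a : 'M[R[i]]_(m, p)) (b : 'M[R[i]]_(n, q))
    (c : 'M[_]_(p, r)) (d : 'M[_]_(q, s)) (v : 'M[V]_(m, n)) :
  sand c d (sand a b v) = sand (a *m c) (b *m d) v.
Proof. by rewrite /sand adjmxM lmulVA rmulVA lrmulVA. Qed.

Lemma sand1 m n (v : 'M[V]_(m, n)) : sand 1%:M 1%:M v = v.
Proof. by rewrite /sand adjmx1 lmul1V rmulV1. Qed.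

Lemma sandD m n p q (a : 'M[R[i]]_(m, p)) (b : 'M[R[i]]_(n, q))
    (v w : 'M[V]_(m, n)) :
  sand a b (v + w) = sand a b v + sand a b w.
Proof.
apply/matrixP=> i j; rewrite [RHS]mxE !sandE -big_split; apply: eq_bigr => k _.
by rewrite -big_split; apply: eq_bigr => l _; rewrite mxE scalerDr.
Qed.

Lemma sand0 m n p q (a : 'M[R[i]]_(m, p)) (b : 'M[R[i]]_(n, q)) :
  sand a b (0 : 'M[V]_(m, n)) = 0.
Proof. by have := sandD a b 0 0; rewrite addr0 -[LHS]addr0 => /addrI. Qed.

Lemma sandN m n p q (a : 'M[R[i]]_(m, p)) (b : 'M[R[i]]_(n, q))
    (v : 'M[V]_(m, n)) :
  sand a b (- v) = - sand a b v.
Proof. by apply/eqP; rewrite -addr_eq0 -sandD addNr sand0. Qed.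

Lemma sandDl m n p q (a a' : 'M[R[i]]_(m, p)) (b : 'M[R[i]]_(n, q))
    (v : 'M[V]_(m, n)) :
  sand (a + a') b v = sand a b v + sand a' b v.
Proof.
apply/matrixP=> i j; rewrite [RHS]mxE !sandE -big_split; apply: eq_bigr => k _.
rewrite -big_split; apply: eq_bigr => l _.
by rewrite mxE rmorphD mulrDl scalerDl.
Qed.

Lemma sandDr m n p q (a : 'M[R[i]]_(m, p)) (b b' : 'M[R[i]]_(n, q))
    (v : 'M[V]_(m, n)) :
  sand a (b + b') v = sand a b v + sand a b' v.
Proof.
apply/matrixP=> i j; rewrite [RHS]mxE !sandE -big_split; apply: eq_bigr => k _.
by rewrite -big_split; apply: eq_bigr => l _; rewrite mxE mulrDr scalerDl.
Qed.

Lemma sand0l m n p q (b : 'M[R[i]]_(n, q)) (v : 'M[V]_(m, n)) :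
  sand (0 : 'M[_]_(m, p)) b v = 0.
Proof.
by have := sandDl (0 : 'M[_]_(m, p)) 0 b v; rewrite addr0 -[LHS]addr0 => /addrI.
Qed.

Lemma sand0r m n p q (a : 'M[R[i]]_(m, p)) (v : 'M[V]_(m, n)) :
  sand a (0 : 'M[_]_(n, q)) v = 0.
Proof.
by have := sandDr a (0 : 'M[_]_(n, q)) 0 v; rewrite addr0 -[LHS]addr0 => /addrI.
Qed.

Lemma sandNl m n p q (a : 'M[R[i]]_(m, p)) (b : 'M[R[i]]_(n, q))
    (v : 'M[V]_(m, n)) :
  sand (- a) b v = - sand a b v.
Proof. by apply/eqP; rewrite -addr_eq0 -sandDl addNr sand0l. Qed.

Lemma sandNr m n p q (a : 'M[R[i]]_(m, p)) (b : 'M[R[i]]_(n, q))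
    (v : 'M[V]_(m, n)) :
  sand a (- b) v = - sand a b v.
Proof. by apply/eqP; rewrite -addr_eq0 -sandDr addNr sand0r. Qed.

Lemma sand_rscale m n p q (a : 'M[R[i]]_(m, p)) (b : 'M[R[i]]_(n, q)) k
    (v : 'M[V]_(m, n)) :
  sand a b (rscaleV k v) = rscaleV k (sand a b v).
Proof.
apply/matrixP=> i j; rewrite [RHS]mxE !sandE scaler_sumr; apply: eq_bigr => r _.
rewrite scaler_sumr; apply: eq_bigr => s _.
by rewrite mxE !scalerA mulrC.
Qed.

Lemma sandZl m n p q x (a : 'M[R[i]]_(m, p)) (b : 'M[R[i]]_(n, q))
    (v : 'M[V]_(m, n)) :
  sand (x%:C *: a) b v = rscaleV x (sand a b v).
Proof.
apply/matrixP=> i j; rewrite [RHS]mxE !sandE scaler_sumr; apply: eq_bigr => r _.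
rewrite scaler_sumr; apply: eq_bigr => s _.
rewrite mxE scalerA mulrA; congr (_ *: _); congr (_ * _).
by rewrite rmorphM; congr (_ * _); exact: conjc_real.
Qed.

Lemma sandZr m n p q x (a : 'M[R[i]]_(m, p)) (b : 'M[R[i]]_(n, q))
    (v : 'M[V]_(m, n)) :
  sand a (x%:C *: b) v = rscaleV x (sand a b v).
Proof.
apply/matrixP=> i j; rewrite [RHS]mxE !sandE scaler_sumr; apply: eq_bigr => r _.
rewrite scaler_sumr; apply: eq_bigr => s _.
by rewrite mxE scalerA mulrCA.
Qed.

Lemma vstar_sum (I : Type) (s : seq I) (F : I -> V) :
  vstar (\sum_(k <- s) F k) = \sum_(k <- s) vstar (F k).
Proof.
elim: s => [|k s IH]; last by rewrite !big_cons vstarD IH.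
by rewrite !big_nil; have := vstarD (0 : V) 0; rewrite addr0 -[LHS]addr0 => /addrI.
Qed.

Lemma vstarN (x : V) : vstar (- x) = - vstar x.
Proof.
apply/eqP; rewrite -addr_eq0 -vstarD addNr.
by have := vstar_sum [::] (fun _ : void => 0); rewrite !big_nil => ->.
Qed.

Lemma starmx_sand m n p q (a : 'M[R[i]]_(m, p)) (b : 'M[R[i]]_(n, q))
    (v : 'M[V]_(m, n)) :
  starmx (sand a b v) = sand b a (starmx v).
Proof.
apply/matrixP=> i j; rewrite 2![LHS]mxE !sandE vstar_sum exchange_big /=.
apply: eq_bigr => k _.
rewrite vstar_sum; apply: eq_bigr => l _.
by rewrite vstarZ rmorphM /= conjcK !mxE mulrC.
Qed.

Lemma starmxD m n (v w : 'M[V]_(m, n)) : starmx (v + w) = starmx v + starmx w.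
Proof. by apply/matrixP=> i j; rewrite !mxE vstarD. Qed.

Lemma starmxK m n (v : 'M[V]_(m, n)) : starmx (starmx v) = v.
Proof. by apply/matrixP=> i j; rewrite !mxE vstarK. Qed.

Lemma sand_scalar n p q (a : 'M[R[i]]_(n, p)) (b : 'M[R[i]]_(n, q)) (x : V) :
  sand a b (x%:M) = map_mx (fun c => c *: x) (adjmx a *m b).
Proof.
apply/matrixP=> i j; rewrite sandE !mxE scaler_suml; apply: eq_bigr => k _.
rewrite (bigD1 k) //= big1 => [|l /negPf lk]; first by rewrite !mxE eqxx addr0.
by rewrite !mxE eq_sym lk scaler0.
Qed.

Lemma lmulV_col m n p q (a : 'M[R[i]]_(m, n)) (a' : 'M[R[i]]_(p, n))
    (v : 'M[V]_(n, q)) :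
  lmulV (col_mx a a') v = col_mx (lmulV a v) (lmulV a' v).
Proof.
apply/matrixP=> i j; case: (split_ordP i) => k ->.
  by rewrite col_mxEu 2!mxE; apply: eq_bigr => l _; rewrite col_mxEu.
by rewrite col_mxEd 2!mxE; apply: eq_bigr => l _; rewrite col_mxEd.
Qed.

Lemma rmulV_row m n p q (b : 'M[R[i]]_(m, n)) (b' : 'M[R[i]]_(m, p))
    (v : 'M[V]_(q, m)) :
  rmulV v (row_mx b b') = row_mx (rmulV v b) (rmulV v b').
Proof.
apply/matrixP=> i j; case: (split_ordP j) => k ->.
  by rewrite row_mxEl 2!mxE; apply: eq_bigr => l _; rewrite row_mxEl.
by rewrite row_mxEr 2!mxE; apply: eq_bigr => l _; rewrite row_mxEr.
Qed.

Lemma rmulV_col m n p q (b : 'M[R[i]]_(m, n)) (v : 'M[V]_(p, m))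
    (w : 'M[V]_(q, m)) :
  rmulV (col_mx v w) b = col_mx (rmulV v b) (rmulV w b).
Proof.
apply/matrixP=> i j; case: (split_ordP i) => k ->.
  by rewrite col_mxEu 2!mxE; apply: eq_bigr => l _; rewrite col_mxEu.
by rewrite col_mxEd 2!mxE; apply: eq_bigr => l _; rewrite col_mxEd.
Qed.

Lemma sand_row m n p q r s (a : 'M[R[i]]_(m, p)) (a' : 'M[_]_(m, r))
    (b : 'M[R[i]]_(n, q)) (b' : 'M[_]_(n, s)) (v : 'M[V]_(m, n)) :
  sand (row_mx a a') (row_mx b b') v =
  block_mx (sand a b v) (sand a b' v) (sand a' b v) (sand a' b' v).
Proof. by rewrite /sand adjmx_row lmulV_col rmulV_col !rmulV_row. Qed.

Lemma sand_col m n p q r s (a : 'M[R[i]]_(m, p)) (a' : 'M[_]_(r, p))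
    (b : 'M[R[i]]_(n, q)) (b' : 'M[_]_(s, q)) (v : 'M[V]_(m, n))
    (w : 'M[V]_(m, s)) (x : 'M[V]_(r, n)) (y : 'M[V]_(r, s)) :
  sand (col_mx a a') (col_mx b b') (block_mx v w x y) =
  sand a b v + sand a b' w + sand a' b x + sand a' b' y.
Proof.
apply/matrixP=> i j; rewrite 3![in RHS]mxE !sandE big_split_ord /= -addrA.
congr (_ + _); rewrite -big_split; apply: eq_bigr => k _;
  rewrite big_split_ord /=; congr (_ + _); apply: eq_bigr => l _.
- by rewrite !col_mxEu row_mxEl.
- by rewrite block_mxEur col_mxEu col_mxEd.
- by rewrite block_mxEdl col_mxEu col_mxEd.
- by rewrite block_mxEdr !col_mxEd.
Qed.

Lemma sand_block m n p q r s t u (a : 'M[R[i]]_(m, p)) (a' : 'M[_]_(r, t))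
    (b : 'M[R[i]]_(n, q)) (b' : 'M[_]_(s, u)) (v : 'M[V]_(m, n))
    (w : 'M[V]_(m, s)) (x : 'M[V]_(r, n)) (y : 'M[V]_(r, s)) :
  sand (block_mx a 0 0 a') (block_mx b 0 0 b') (block_mx v w x y) =
  block_mx (sand a b v) (sand a b' w) (sand a' b x) (sand a' b' y).
Proof.
rewrite sand_col !sand_row !add_block_mx.
by rewrite !sand0l !sand0r !addr0 !add0r.
Qed.

(** The right-hand side is [sand] over [W] written out, because inside this section [sand] is tied
    to [V]. *)
Lemma sand_map (W : starVectType R) (phi : {linear V -> W}) m n p q
    (a : 'M[R[i]]_(m, p)) (b : 'M[R[i]]_(n, q)) (v : 'M[V]_(m, n)) :
  map_mx phi (sand a b v) = rmulV (lmulV (adjmx a) (map_mx phi v)) b.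
Proof.
apply/matrixP=> i j; rewrite [LHS]mxE !mxE raddf_sum /=; apply: eq_bigr => l _.
rewrite linearZ /= !mxE raddf_sum /=; congr (_ *: _); apply: eq_bigr => k _.
by rewrite linearZ /= !mxE.
Qed.

Lemma rscaleVD m n k l (v : 'M[V]_(m, n)) :
  rscaleV (k + l) v = rscaleV k v + rscaleV l v.
Proof. by apply/matrixP=> i j; rewrite !mxE rmorphD scalerDl. Qed.

Lemma rscaleVM m n k l (v : 'M[V]_(m, n)) :
  rscaleV (k * l) v = rscaleV k (rscaleV l v).
Proof. by apply/matrixP=> i j; rewrite !mxE rmorphM scalerA. Qed.

Lemma rscaleVDr m n k (v w : 'M[V]_(m, n)) :
  rscaleV k (v + w) = rscaleV k v + rscaleV k w.
Proof. by apply/matrixP=> i j; rewrite !mxE scalerDr. Qed.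

Lemma rscaleV_block m n r s k (v : 'M[V]_(m, n)) w x (y : 'M[V]_(r, s)) :
  rscaleV k (block_mx v w x y) =
  block_mx (rscaleV k v) (rscaleV k w) (rscaleV k x) (rscaleV k y).
Proof. by rewrite /rscaleV map_block_mx. Qed.

Lemma starmx_rscale m n k (v : 'M[V]_(m, n)) :
  starmx (rscaleV k v) = rscaleV k (starmx v).
Proof. by apply/matrixP=> i j; rewrite !mxE vstarZ conjc_real. Qed.

End Sandwich.

(** * Absolute values and partial unitaries under unitaries and coisometries *)

Section AbsUnitary.
Variables (R : realType) (V : absMatrixOrderUnitType R).

Lemma mxpos_sand m n (a : 'M[R[i]]_(m, n)) (v : 'M[V]_m) :
  mxpos m v -> mxpos n (sand a a v).
Proof. exact: mxposJ. Qed.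

(** Properness of the cone is an axiom at size one only; at size [n] it comes from the absolute
    value. If [x] and [- x] are positive, then [x = |x| = |- x| = - x], hence [x = 0]. *)
Lemma mxpos_antisym n (u v : 'M[V]_n) :
  mxpos n (u - v) -> mxpos n (v - u) -> u = v.
Proof.
move=> uv vu; have /(congr1 (+%R^~ (u - v))) : v - u = u - v.
  by rewrite -(mxabs_id vu) -opprB mxabsN ?mxabs_id //; exact: mxpos_sa.
rewrite -opprB addNr => /esym/matrixP h; apply/eqP; rewrite -subr_eq0.
apply/eqP/matrixP=> i j; have := h i j; rewrite [LHS]mxE [RHS]mxE.
rewrite -mulr2n -scaler_nat => /eqP; rewrite scaler_eq0 pnatr_eq0 /=.
by move=> /eqP->; rewrite mxE.
Qed.

(** This is the axiom [mxabsM] for the left factor [a^*], whose norm is at most [1]; the missing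
    multiple [1 - opnorm (adjmx a)] of a positive element is added back. *)
Lemma mxabs_sand_le m n p q (a : 'M[R[i]]_(m, p)) (b : 'M[_]_(n, q))
    (v : 'M[V]_(m, n)) : coisometry a ->
  mxpos q (mxabs (sand 1%:M b (mxabs v)) - mxabs (sand a b v)).
Proof.
move=> ca; have := mxabsM _ _ _ _ (adjmx a) v b.
set x := mxabs (rmulV _ _) => h.
have -> : sand 1%:M b (mxabs v) = rmulV (mxabs v) b.
  by rewrite /sand adjmx1 lmul1V.
have o1 : opnorm (adjmx a) <= 1 by apply: opnorm_isometry; rewrite adjmxK.
have -> : x - mxabs (sand a b v) = rscaleV (1 - opnorm (adjmx a)) x +
    (rscaleV (opnorm (adjmx a)) x - mxabs (sand a b v)).
  by rewrite addrA -rscaleVD subrK rscaleV1.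
by apply: mxposD h; apply: mxposZ; [rewrite subr_ge0|exact: mxabs_pos].
Qed.

(** The previous inequality holds for [a] and for [a^*], and antisymmetry concludes. A unitary is
    typed with two sizes [m] and [k] because the one used below has type ['M_(m + k, k + m)]. *)
Lemma mxabs_lunitary m k n (a : 'M[R[i]]_(m, k)) (v : 'M[V]_(m, n)) :
  coisometry a -> coisometry (adjmx a) -> mxabs (sand a 1%:M v) = mxabs v.
Proof.
move=> ca ca'; apply: mxpos_antisym.
  have := mxabs_sand_le 1%:M (sand a 1%:M v) ca'.
  by rewrite sand_sand mulmx1 ca !sand1 (mxabs_id (mxabs_pos _ _ _)).
by have := mxabs_sand_le 1%:M v ca; rewrite sand1 (mxabs_id (mxabs_pos _ _ _)).
Qed.

(** Multiplying [v a] on the left by [a^*] keeps its absolute value and produces the positive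
    element [a^* v a]. *)
Lemma mxabs_runitary_pos m k (a : 'M[R[i]]_(m, k)) (v : 'M[V]_m) :
  coisometry a -> coisometry (adjmx a) -> mxpos m v ->
  mxabs (sand 1%:M a v) = sand a a v.
Proof.
move=> ca ca' v0; rewrite -(mxabs_lunitary (sand 1%:M a v) ca ca') sand_sand.
by rewrite mul1mx mulmx1 mxabs_id //; exact: mxpos_sand.
Qed.

Lemma mxabs_unitary m k (a : 'M[R[i]]_(m, k)) (v : 'M[V]_m) :
  coisometry a -> coisometry (adjmx a) ->
  mxabs (sand a a v) = sand a a (mxabs v).
Proof.
move=> ca ca'; have a'a : adjmx a *m a = 1%:M by rewrite -{2}(adjmxK a).
have -> : sand a a v = sand a 1%:M (sand 1%:M a v).
  by rewrite sand_sand mul1mx mulmx1.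
rewrite mxabs_lunitary //; apply: mxpos_antisym; last first.
  have := mxabs_sand_le a v (coisometry1 R m).
  by rewrite (mxabs_runitary_pos ca ca' (mxabs_pos _ _ v)).
have := mxabs_sand_le (adjmx a) (sand 1%:M a v) (coisometry1 R m).
rewrite (@mxabs_runitary_pos _ _ (adjmx a) (mxabs _)) ?adjmxK //; last first.
  exact: mxabs_pos.
rewrite sand_sand mul1mx ca sand1.
by move=> /(mxpos_sand a); rewrite sandD sandN sand_sand a'a sand1.
Qed.

Lemma dsum_inj m n (u u' : 'M[V]_m) (v v' : 'M[V]_n) :
  dsum u v = dsum u' v' -> u = u' /\ v = v'.
Proof. by move/eq_block_mx=> [-> _ _ ->]. Qed.

Lemma ounit_dsum m n :
  (ounit%:M : 'M[V]_(m + n)) = dsum (ounit%:M : 'M[V]_m) (ounit%:M : 'M[V]_n).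
Proof. exact: scalar_mx_block. Qed.

(** Involution, absolute value and unit all act block by block, so a zero block added to reach a
    unitary can be removed again. *)
Lemma partial_unitary_dsuml m n (u : 'M[V]_m) (v : 'M[V]_n) :
  partial_unitary (dsum u v) -> partial_unitary u.
Proof.
rewrite /partial_unitary /order_projection starmx_dsum !mxabs_dsum starmx_dsum.
move=> [/dsum_inj[u1 _] [/dsum_inj[u2 _] u3]]; split=> //; split=> //.
move: u3; rewrite !ounit_dsum /dsum mulr2n add_block_mx opp_block_mx.
by rewrite add_block_mx !oppr0 !addr0 mxabs_dsum -mulr2n => /dsum_inj[].
Qed.

(** Conjugation by a unitary commutes with the involution and with the absolute value, and it fixes
    the unit. *)
Lemma partial_unitary_unitary m k (a : 'M[R[i]]_(m, k)) (u : 'M[V]_m) :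
  coisometry a -> coisometry (adjmx a) ->
  partial_unitary u -> partial_unitary (sand a a u).
Proof.
move=> ca ca' [u1 [u2 u3]].
have eE : (ounit%:M : 'M[V]_k) = sand a a ounit%:M.
  by rewrite sand_scalar -{2}(adjmxK a) ca'; apply/matrixP=> i j;
    rewrite !mxE; case: eqP; rewrite ?scale1r ?scale0r.
split; first by rewrite starmx_sand !mxabs_unitary // u1.
rewrite mxabs_unitary //; split; first by rewrite starmx_sand u2.
by rewrite eE mulr2n -!sandD -sandN -sandD -mulr2n mxabs_unitary // u3.
Qed.

(* A coisometry [a] extends to the unitary [[a, 0], [1 - a^* a, a^*]], which
   conjugates [u (+) 0] to [(a^* u a) (+) 0]. *)
Lemma partial_unitary_coisometry m k (a : 'M[R[i]]_(m, k)) (u : 'M[V]_m) :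
  coisometry a -> partial_unitary u -> partial_unitary (sand a a u).
Proof.
move=> ca pu; pose p := adjmx a *m a; have aa : a *m adjmx a = 1%:M := ca.
have p' : adjmx (1%:M - p) = 1%:M - p.
  by rewrite adjmxD adjmxN adjmx1 adjmxM adjmxK.
have ap : a *m (1%:M - p) = 0 by rewrite mulmxBr mulmxA aa mul1mx mulmx1 subrr.
have pa : (1%:M - p) *m adjmx a = 0.
  by rewrite mulmxBl -mulmxA aa mul1mx mulmx1 subrr.
have pp : (1%:M - p) *m (1%:M - p) = 1%:M - p.
  by rewrite [LHS]mulmxBl mul1mx -mulmxA ap mulmx0 subr0.
pose b := block_mx a 0 (1%:M - p) (adjmx a) : 'M[R[i]]_(m + k, k + m).
have bE : sand b b (dsum u 0) = dsum (sand a a u) (0 : 'M[V]_m).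
  by rewrite /dsum sand_col !sand0 !addr0 sand_row !sand0l !sand0r.
apply: (@partial_unitary_dsuml _ m _ 0); rewrite -bE.
apply: partial_unitary_unitary.
- rewrite /coisometry adjmx_block mulmx_block p' adjmxK adjmx0 !mul0mx !addr0.
  by rewrite aa ap pa pp subrK mulmx0 addr0 -scalar_mx_block.
- rewrite /coisometry adjmxK adjmx_block mulmx_block p' adjmxK adjmx0 !mul0mx.
  by rewrite !mulmx0 pp pa ap aa !add0r addrC subrK -scalar_mx_block.
- by apply: partial_unitary_dsum => //; exact: partial_unitary0.
Qed.

End AbsUnitary.

(** * Estimates for the matrix norms *)

Section NormBound.
Variables (R : realType) (V : absMatrixOrderUnitType R).

(** The condition whose infimum over [k > 0] is [mxnorm v]. Estimates are made on it directly, which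
    avoids handling infima. *)
Definition normb n (k : R) (v : 'M[V]_n) : Prop :=
  mxpos (n + n) (block_mx (rscaleV k ounit%:M) v (starmx v)
                          (rscaleV k ounit%:M)).

Lemma normbD n k l (v w : 'M[V]_n) :
  normb k v -> normb l w -> normb (k + l) (v + w).
Proof.
move=> nv nw; have := mxposD _ _ _ nv nw.
by rewrite add_block_mx -!rscaleVD -starmxD.
Qed.

Lemma normbZ n x k (v : 'M[V]_n) :
  0 <= x -> normb k v -> normb (x * k) (rscaleV x v).
Proof.
move=> x0 nv; have := mxposZ _ _ _ x0 nv.
by rewrite rscaleV_block -!rscaleVM -starmx_rscale.
Qed.

Lemma rscaleV0 m n k : rscaleV k (0 : 'M[V]_(m, n)) = 0.
Proof. by apply/matrixP=> i j; rewrite !mxE scaler0. Qed.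

Lemma normb0 n k : 0 <= k -> normb k (0 : 'M[V]_n).
Proof.
move=> k0; have := mxposZ _ _ _ k0 (ounitmx_pos V (n + n)).
by rewrite scalar_mx_block rscaleV_block !rscaleV0 /normb starmx0.
Qed.

Lemma normb_le n k l (v : 'M[V]_n) : k <= l -> normb k v -> normb l v.
Proof.
move=> kl nv; rewrite -[l](subrKC k) -[v]addr0; apply: normbD => //.
by apply: normb0; rewrite subr_ge0.
Qed.

(** Conjugating the defining 2 by 2 matrix by [diag(a, b)] gives the right off-diagonal blocks, but
    the diagonal becomes [k a^* a] and [k b^* b]. Adding the positive [k (1 - a^* a)] and
    [k (1 - b^* b)] restores it. *)
Lemma normb_sand m n k (a b : 'M[R[i]]_(m, n)) (v : 'M[V]_m) :
  coisometry a -> coisometry b -> 0 <= k -> normb k v -> normb k (sand a b v).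
Proof.
(* Since [q] is a self-adjoint idempotent, conjugating [k e] by [q] yields [k q e], which
   complements [k c^* c e] to [k e]. *)
have qE (c : 'M[R[i]]_(m, n)) (q := 1%:M - adjmx c *m c) : coisometry c ->
    rscaleV k ounit%:M =
    sand c c (rscaleV k ounit%:M) + sand q q (rscaleV k ounit%:M) :> 'M[V]_n.
  move=> cc; have -> : sand q q (rscaleV k ounit%:M) =
      rscaleV k (map_mx (fun c => c *: ounit) q) :> 'M[V]_n.
    rewrite sand_rscale sand_scalar; congr (rscaleV k (map_mx _ _)).
    rewrite adjmxD adjmxN adjmx1 adjmxM adjmxK -/q [LHS]mulmxBl mul1mx -mulmxA.
    by rewrite mulmxBr mulmx1 mulmxA (cc : c *m _ = _) mul1mx subrr mulmx0 subr0.
  rewrite sand_rscale sand_scalar -rscaleVDr; congr rscaleV.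
  apply/matrixP=> i j; rewrite !mxE -scalerDl subrKC.
  by case: eqP; rewrite ?scale1r ?scale0r.
move=> ca cb k0 nv; rewrite /normb starmx_sand.
rewrite [X in block_mx X](qE a ca) [X in block_mx _ _ _ X](qE b cb).
set qa := _ - _; set qb := _ - _.
have := mxpos_sand (block_mx qa 0 0 qb) (normb0 n k0).
have := mxpos_sand (block_mx a 0 0 b) nv; rewrite !sand_block starmx0 !sand0.
by move=> h1 h2; have := mxposD _ _ _ h1 h2; rewrite add_block_mx !addr0.
Qed.

Lemma normbN n k (v : 'M[V]_n) : 0 <= k -> normb k v -> normb k (- v).
Proof.
move=> k0 nv; rewrite -(sand1 v) -sandNr.
apply: normb_sand => //; first exact: coisometry1.
by rewrite /coisometry adjmxN adjmx1 mulNmx mulmxN opprK mulmx1.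
Qed.

Lemma sand_1scalar m n (c : R[i]) (v : 'M[V]_(m, n)) :
  sand 1%:M c%:M v = map_mx (fun x => c *: x) v.
Proof.
rewrite /sand adjmx1 lmul1V; apply/matrixP=> i j; rewrite !mxE (bigD1 j) //=.
rewrite big1 => [|k /negPf kj]; first by rewrite mxE eqxx addr0.
by rewrite mxE kj scale0r.
Qed.

(** The block matrix with diagonal [k e] and off-diagonal [v] is the half-sum of [k e + v]
    conjugated by the row [(1, 1)] and [k e - v] conjugated by the row [(1, -1)]. *)
Lemma normb_sa n k (v : 'M[V]_n) : samx v ->
  mxpos n (rscaleV k ounit%:M + v) -> mxpos n (rscaleV k ounit%:M - v) ->
  normb k v.
Proof.
move=> sv vp vn; have h0 : 0 <= 2^-1 :> R by rewrite invr_ge0.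
have := mxposD _ _ _
  (mxpos_sand (row_mx 1%:M 1%:M) (mxposZ _ _ _ h0 vp))
  (mxpos_sand (row_mx 1%:M (- 1%:M)) (mxposZ _ _ _ h0 vn)).
rewrite !sand_row !sandNl !sandNr !opprK !sand1 add_block_mx.
have hN (w : 'M[V]_n) : - rscaleV 2^-1 w = rscaleV 2^-1 (- w).
  by apply/matrixP=> i j; rewrite !mxE scalerN.
have hE (w : 'M[V]_n) : rscaleV 2^-1 w + rscaleV 2^-1 w = w.
  by rewrite -rscaleVD -[X in _ + X]mul1r -[X in X + _]mul1r -splitr rscaleV1.
have -> : rscaleV 2^-1 (rscaleV k ounit%:M + v) +
    rscaleV 2^-1 (rscaleV k ounit%:M - v) = rscaleV k ounit%:M.
  rewrite !(rscaleVDr (2^-1)) addrACA hE -(rscaleVDr (2^-1)) subrr rscaleV0.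
  exact: addr0.
have -> : rscaleV 2^-1 (rscaleV k ounit%:M + v) -
    rscaleV 2^-1 (rscaleV k ounit%:M - v) = v.
  rewrite hN opprB -(rscaleVDr (2^-1)) [_ + v]addrC addrACA subrr addr0.
  by rewrite (rscaleVDr (2^-1)) hE.
by rewrite -[X in block_mx _ _ X](sv : starmx v = v).
Qed.

(** The order unit bounds self-adjoint elements; a general [v] is split into real and imaginary
    parts, and the factor [i], being unimodular, keeps bounds. *)
Lemma normb_ex1 (v : 'M[V]_1) : exists2 k, 0 < k & normb k v.
Proof.
have ex_sa (w : 'M[V]_1) : samx w -> exists2 k, 0 < k & normb k w.
  move=> sw; have [k k0 [h1 h2]] := ounitP w sw; exists k => //.
  have eE : const_mx ounit = ounit%:M :> 'M[V]_1.
    by apply/matrixP=> i j; rewrite !ord1 !mxE.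
  by apply: normb_sa; rewrite -?eE.
pose h := 2^-1 : R; pose i0 : R[i] := Complex 0 1.
have i0c : conjc i0 = - i0 by apply/eqP; rewrite eq_complex /= oppr0 !eqxx.
have i0c' : conjc (- i0) = i0 by rewrite -i0c conjcK.
have i0i : i0 * i0 = -1.
  by apply/eqP; rewrite eq_complex /= !mulr0 !mul0r mulr1 addr0 sub0r oppr0 !eqxx.
pose re := rscaleV h (v + starmx v); pose im := rscaleV h (v - starmx v).
(* [im] is skew-adjoint, so [- i0] times it is self-adjoint. *)
pose im' := map_mx (fun x => - i0 *: x) im.
have [k k0 nk] : exists2 k, 0 < k & normb k re.
  apply: ex_sa.
  by rewrite /samx /= starmx_rscale starmxD starmxK addrC.
have [l l0 nl] : exists2 l, 0 < l & normb l im'.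
  apply: ex_sa; apply/matrixP=> i j; rewrite !ord1 !mxE vstarZ.
  by rewrite vstarZ conjc_real vstarD vstarN vstarK i0c' -opprB !scalerN scaleNr.
exists (k + l); first exact: addr_gt0.
have -> : v = re + sand 1%:M i0%:M im'.
  rewrite sand_1scalar; apply/matrixP=> i j; rewrite !ord1 !mxE.
  rewrite scalerA mulrN i0i opprK scale1r -scalerDr addrACA subrr addr0.
  rewrite -mulr2n -scaler_nat scalerA.
  rewrite -(rmorph_nat (real_complex R) 2) -rmorphM mulVf ?pnatr_eq0 //.
  by rewrite rmorph1 scale1r.
apply: normbD => //; apply: normb_sand nl; [exact: coisometry1| |exact: ltW].
by apply: coisometry_scalar; rewrite i0c mulrN i0i opprK.
Qed.

Lemma sand_delta n (x : V) (i j k l : 'I_n) :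
  sand (delta_mx 0 i) (delta_mx 0 j) (const_mx x : 'M[V]_1) k l =
  if (k == i) && (l == j) then x else 0.
Proof.
rewrite sandE !big_ord1 !mxE !eqxx !andTb rmorph_nat -natrM mulnb.
by case: (_ && _); rewrite ?scale1r ?scale0r.
Qed.

(** Each entry is moved to its place by coisometric unit rows, which keep its bound, and finitely
    many bounds add up. Thus the infimum in [mxnorm] is over a nonempty set. *)
Lemma normb_ex n (v : 'M[V]_n) : exists2 k, 0 < k & normb k v.
Proof.
have -> : v = \sum_i \sum_j sand (delta_mx 0 i) (delta_mx 0 j)
    (const_mx (v i j) : 'M[V]_1).
  apply/matrixP=> i j; rewrite summxE.
  under eq_bigr => k _.
    rewrite summxE; under eq_bigr => l _ do rewrite sand_delta.
    over.
  rewrite (bigD1 i) //= [X in _ = _ + X]big1 => [|k /negPf ki].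
    rewrite addr0 (bigD1 j) //= !eqxx big1 ?addr0 // => l /negPf lj.
    by rewrite eq_sym lj.
  by rewrite big1 // => l _; rewrite eq_sym ki.
apply: (big_ind (fun w => exists2 k, 0 < k & normb k w)).
- by exists 1 => //; exact: normb0.
- move=> x y [k k0 nk] [l l0 nl]; exists (k + l); first exact: addr_gt0.
  exact: normbD.
move=> i _; apply: (big_ind (fun w => exists2 k, 0 < k & normb k w)).
- by exists 1 => //; exact: normb0.
- move=> x y [k k0 nk] [l l0 nl]; exists (k + l); first exact: addr_gt0.
  exact: normbD.
move=> j _; have [k k0 nk] := normb_ex1 (const_mx (v i j)); exists k => //.
by apply: normb_sand nk; [exact: coisometry_delta..|exact: ltW].
Qed.

Lemma mxnorm_ge0 n (v : 'M[V]_n) : 0 <= mxnorm v.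
Proof.
have [k k0 nk] := normb_ex v; apply: lb_le_inf; first by exists k.
by move=> x [/ltW].
Qed.

Lemma mxnorm_le n k (v : 'M[V]_n) : 0 < k -> normb k v -> mxnorm v <= k.
Proof.
move=> k0 nk; apply: ge_inf => //.
by exists 0 => x [/ltW].
Qed.

Lemma mxnorm_lt n k (v : 'M[V]_n) : mxnorm v < k -> normb k v.
Proof.
move=> vk; have [l l0 nl] := normb_ex v.
have [|x [_ nx] xk] := inf_lt _ vk; first by exists l.
exact: normb_le (ltW xk) nx.
Qed.

End NormBound.

(** * Norm-continuous paths and homotopies of partial unitaries *)

Section Homotopy.
Variables (R : realType) (V : absMatrixOrderUnitType R).

(** The epsilon-delta form of the continuity required in [homotopic], with [normb e] in place of a
    strict norm inequality. *)
Definition normcts n (f : R -> 'M[V]_n) : Prop :=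
  forall t, t \in `[0, 1] -> forall e, 0 < e ->
  exists2 d, 0 < d &
  forall s, s \in `[0, 1] -> `|s - t| < d -> normb e (f s - f t).

Lemma normctsP n (f : R -> 'M[V]_n) :
  normcts f <-> forall t, t \in `[0, 1] ->
    mxnorm (f s - f t) @[s --> within `[0, 1] (nbhs t)] --> (0 : R).
Proof.
split=> [cf t t01|cf t t01 e e0].
  (* [normb] only gives a non-strict bound on the norm, so half of [e] is used to reach a strict
     one. *)
  apply/cvgrPdist_lt => e e0; have e20 : 0 < e / 2 by exact: divr_gt0.
  have [d d0 h] := cf t t01 _ e20.
  rewrite near_withinE; apply/nbhs_ballP; exists d => // s /= st s01.
  rewrite sub0r normrN ger0_norm ?mxnorm_ge0 //.
  apply: (@le_lt_trans _ _ (e / 2)); last by rewrite ltr_pdivrMr // ltr_pMr // ltr1n.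
  apply: mxnorm_le => //.
  by apply: h => //; rewrite distrC.
have /cvgrPdist_lt/(_ e e0) := cf t t01.
rewrite near_withinE => /nbhs_ballP[d /= d0 h]; exists d => // s s01 st.
have := h s; rewrite /ball /= distrC => /(_ st s01).
by rewrite sub0r normrN ger0_norm ?mxnorm_ge0 // => /mxnorm_lt.
Qed.

Lemma homotopicP n (u v : 'M[V]_n) : homotopic u v <->
  exists f : R -> 'M[V]_n,
    [/\ forall t, t \in `[0, 1] -> partial_unitary (f t),
        normcts f, f 0 = u & f 1 = v].
Proof.
by split=> -[f [pf cf f0 f1]]; exists f; split=> //; apply/normctsP.
Qed.

Lemma normctsD n (f g : R -> 'M[V]_n) :
  normcts f -> normcts g -> normcts (fun t => f t + g t).
Proof.
move=> cf cg t t01 e e0; have e20 : 0 < e / 2 by exact: divr_gt0.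
have [d d0 hf] := cf t t01 _ e20; have [c c0 hg] := cg t t01 _ e20.
exists (Num.min d c); first by rewrite lt_min d0.
move=> s s01; rewrite lt_min => /andP[sd sc].
rewrite opprD addrACA [e]splitr; apply: normbD; [exact: hf|exact: hg].
Qed.

Lemma normcts_cst n (u : 'M[V]_n) : normcts (fun=> u).
Proof.
by move=> t _ e e0; exists 1 => // s _ _; rewrite subrr; exact/normb0/ltW.
Qed.

(** The Lipschitz constant [2] is the speed at which each path is run through in a concatenation. *)
Lemma normcts_comp n (f : R -> 'M[V]_n) (g : R -> R) :
  (forall t, t \in `[0, 1] -> g t \in `[0, 1]) ->
  (forall s t, `|g s - g t| <= 2 * `|s - t|) ->
  normcts f -> normcts (f \o g).
Proof.
move=> g01 gl cf t t01 e e0; have [d d0 h] := cf _ (g01 t t01) e e0.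
exists (d / 2); first exact: divr_gt0.
move=> s s01 st; apply: h; first exact: g01.
by rewrite (le_lt_trans (gl s t)) // mulrC -ltr_pdivlMr.
Qed.

Lemma normcts_rscale n (g : R -> R) (w : 'M[V]_n) :
  continuous g -> normcts (fun t => rscaleV (g t) w).
Proof.
move=> cg t _ e e0; have [k k0 nw] := normb_ex w.
have /cvgrPdist_lt/(_ _ (divr_gt0 e0 k0)) := cg t.
move=> /nbhs_ballP[d /= d0 h]; exists d => // s s01 st.
have {}h : `|g s - g t| < e / k.
  by rewrite distrC; apply: h; rewrite /ball /= distrC.
have -> : rscaleV (g s) w - rscaleV (g t) w = rscaleV (g s - g t) w.
  by rewrite -[LHS]addr0; apply/matrixP=> i j; rewrite !mxE addr0 -scalerBl -rmorphB.
have nabs : normb e (rscaleV `|g s - g t| w).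
  (* Scaling of bounds is available for nonnegative factors, so the absolute value is treated first
     and the sign is put back by [normbN]. *)
  apply: normb_le (normbZ (normr_ge0 (g s - g t)) nw).
  by rewrite -ler_pdivlMr // ltW.
case: (ger0P (g s - g t)) nabs => // _ /(normbN (ltW e0)).
by rewrite -rscaleVN1 -rscaleVM mulN1r opprK.
Qed.

Lemma normcts_sand m n (a : 'M[R[i]]_(m, n)) (f : R -> 'M[V]_m) :
  coisometry a -> normcts f -> normcts (fun t => sand a a (f t)).
Proof.
move=> ca cf t t01 e e0; have [d d0 h] := cf t t01 e e0.
exists d => // s s01 st; rewrite -sandN -sandD.
by apply: normb_sand => //; [exact: ltW|exact: h].
Qed.

Lemma homotopic_refl n (u : 'M[V]_n) : partial_unitary u -> homotopic u u.
Proof.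
by move=> pu; apply/homotopicP; exists (fun=> u); split=> //; exact: normcts_cst.
Qed.

Lemma homotopic_sym n (u v : 'M[V]_n) : homotopic u v -> homotopic v u.
Proof.
move=> /homotopicP[f [pf cf f0 f1]]; apply/homotopicP.
have g01 (t : R) : t \in `[0, 1] -> 1 - t \in `[0, 1].
  by rewrite !in_itv /= subr_ge0 lerBlDr lerDl => /andP[-> ->].
exists (f \o (fun t => 1 - t)); split; rewrite /= ?subr0 ?subrr //.
- by move=> t /g01; exact: pf.
- apply: normcts_comp cf => // s t.
  by rewrite opprB addrC addrA subrK distrC ler_peMl // ler1n.
Qed.

(* Writing the concatenation as a sum spares a case analysis for its continuity. *)
Lemma homotopic_trans n (u v w : 'M[V]_n) :
  homotopic u v -> homotopic v w -> homotopic u w.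
Proof.
move=> /homotopicP[f [pf cf f0 f1]] /homotopicP[g [pg cg g0 g1]].
apply/homotopicP.
pose a (t : R) := Num.min (2 * t) 1; pose b (t : R) := Num.max (2 * t - 1) 0.
have a01 t : t \in `[0, 1] -> a t \in `[0, 1].
  rewrite !in_itv /= /a => /andP[t0 t1]; rewrite le_min ge_min lexx orbT ler01.
  by rewrite mulr_ge0.
have b01 t : t \in `[0, 1] -> b t \in `[0, 1].
  rewrite !in_itv /= /b => /andP[t0 t1]; rewrite le_max ge_max lexx orbT ler01.
  by rewrite andbT lerBlDr -[1 + 1]/(2 : R) ler_piMr.
(* At every time one of the two summands rests at the junction [v]; subtracting [v] leaves the
   moving one. *)
exists (fun t => (f \o a) t + (g \o b) t - v); split.
- move=> t t01; case: (leP (2 * t) 1) => t2.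
    have bt : b t = 0 by rewrite /b; apply/max_idPr; rewrite subr_le0.
    by rewrite /= bt g0 addrK; exact/pf/a01.
  have at1 : a t = 1 by rewrite /a; apply/min_idPr; exact: ltW.
  by rewrite /= at1 f1 addrAC subrr add0r; exact/pg/b01.
- apply: normctsD; last exact: normcts_cst.
  apply: normctsD.
    apply: normcts_comp cf => // s t.
    have := ler_norm (s - t); have := ler_norm (t - s); rewrite distrC /a => h1 h2.
    rewrite ler_norml; case: (leP (2 * s) 1) => ?; case: (leP (2 * t) 1) => ?;
      apply/andP; split; lra.
  apply: normcts_comp cg => // s t.
  have := ler_norm (s - t); have := ler_norm (t - s); rewrite distrC /b => h1 h2.
  rewrite ler_norml; case: (leP (2 * s - 1) 0) => ?;
    case: (leP (2 * t - 1) 0) => ?; apply/andP; split; lra.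
- by rewrite /= /a /b !mulr0 sub0r min_l ?max_r ?g0 ?addrK ?f0 ?lerN10.
- have a1 : a 1 = 1 by rewrite /a mulr1 min_r // ler1n.
  have b1 : b 1 = 1 by rewrite /b mulr1 [_ - 1]addrK max_l // ler01.
  by rewrite /= a1 b1 f1 g1 addrAC subrr add0r.
Qed.

Lemma homotopic_sand m n (a : 'M[R[i]]_(m, n)) (u v : 'M[V]_m) :
  coisometry a -> homotopic u v -> homotopic (sand a a u) (sand a a v).
Proof.
move=> ca /homotopicP[f [pf cf f0 f1]]; apply/homotopicP.
exists (fun t => sand a a (f t)); rewrite f0 f1; split=> //.
- by move=> t /pf; exact: partial_unitary_coisometry.
- exact: normcts_sand.
Qed.

(** Reduces continuity of a direct sum of paths to that of sums and coisometric conjugates. *)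
Lemma dsum_sand m n (u : 'M[V]_m) (v : 'M[V]_n) :
  dsum u v = sand (row_mx 1%:M 0) (row_mx 1%:M 0) u +
             sand (row_mx 0 1%:M) (row_mx 0 1%:M) v.
Proof.
by rewrite !sand_row !sand1 !sand0l !sand0r add_block_mx !addr0 !add0r.
Qed.

Lemma homotopic_dsum m n (u u' : 'M[V]_m) (v v' : 'M[V]_n) :
  homotopic u u' -> homotopic v v' -> homotopic (dsum u v) (dsum u' v').
Proof.
move=> /homotopicP[f [pf cf f0 f1]] /homotopicP[g [pg cg g0 g1]].
apply/homotopicP; exists (fun t => dsum (f t) (g t)).
rewrite f0 f1 g0 g1; split=> //.
- by move=> t t01; apply: partial_unitary_dsum; [exact: pf|exact: pg].
- under eq_fun => t do rewrite dsum_sand.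
  apply: normctsD; apply: normcts_sand => //.
  + exact/coisometry_row0/coisometry1.
  + exact/coisometry_0row/coisometry1.
Qed.

(* With [a b^* = 0] every [cos t a + sin t b] is a coisometry. *)
Lemma homotopic_orth m n (a b : 'M[R[i]]_(m, n)) (u : 'M[V]_m) :
  coisometry a -> coisometry b -> a *m adjmx b = 0 -> partial_unitary u ->
  homotopic (sand a a u) (sand b b u).
Proof.
move=> ca cb ab pu; apply/homotopicP.
have ba : b *m adjmx a = 0 by rewrite -[LHS]adjmxK adjmxM adjmxK ab adjmx0.
pose c (t : R) := cos (t * (pi / 2)); pose s (t : R) := sin (t * (pi / 2)).
pose r t := (c t)%:C *: a + (s t)%:C *: b.
have cr t : coisometry (r t).
  rewrite /coisometry /r adjmxD !adjmxZ !conjc_real mulmxDl !mulmxDr.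
  rewrite -!scalemxAl -!scalemxAr (ca : a *m _ = _) (cb : b *m _ = _) ab ba.
  rewrite !scaler0 addr0 add0r !scalerA -scalerDl -!rmorphM -rmorphD.
  by rewrite -!expr2 cos2Dsin2 scale1r.
exists (fun t => sand (r t) (r t) u); split.
- by move=> t _; exact: partial_unitary_coisometry.
(* Expanded, the path is a combination of three fixed matrices with continuous real coefficients. *)
- have -> : (fun t => sand (r t) (r t) u) = (fun t =>
      rscaleV (c t * c t) (sand a a u) + rscaleV (s t * s t) (sand b b u) +
      rscaleV (c t * s t) (sand a b u + sand b a u)).
    apply/funext => t; rewrite sandDl !sandDr !sandZl !sandZr.
    rewrite -!rscaleVM rscaleVDr [s t * c t]mulrC.
    by rewrite -[LHS]addrA -[RHS]addrA; congr (_ + _); rewrite addrA addrC.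
  have lc : continuous (fun t : R => t * (pi / 2)) by exact: mulrr_continuous.
  have cc : continuous c.
    by move=> t; apply: continuous_comp; [exact: lc|exact: continuous_cos].
  have cs : continuous s.
    by move=> t; apply: continuous_comp; [exact: lc|exact: continuous_sin].
  by apply: normctsD; first apply: normctsD; apply: normcts_rscale => t;
    apply: continuousM; first [exact: cc|exact: cs].
- by rewrite /r /c /s mul0r cos0 sin0 scale0r addr0 scale1r.
- by rewrite /r /c /s mul1r cos_pihalf sin_pihalf scale0r add0r scale1r.
Qed.

End Homotopy.

(** * The coisometric form of the relation [simK] *)

Section StableEquivalence.
Variables (R : realType) (V : absMatrixOrderUnitType R).

Definition stable_homotopic m n (u : 'M[V]_m) (v : 'M[V]_n) : Prop :=
  exists k (a : 'M[R[i]]_(m, k)) (b : 'M[R[i]]_(n, k)),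
    [/\ coisometry a, coisometry b & homotopic (sand a a u) (sand b b v)].

Lemma padmxE k m (u : 'M[V]_m) : (m <= k)%N ->
  padmx k u = sand (pid_mx m) (pid_mx m) u.
Proof.
move=> mk; rewrite /padmx; move: (k - m)%N (subnKC mk) => d e.
case: _ / e; rewrite conform_mx_id pid_mx_row sand_row sand1.
by rewrite !sand0l sand0r.
Qed.

(** [a] and [b] need not be orthogonal to each other, but both are orthogonal to a coisometry
    supported on the [l >= m] extra columns; the homotopy goes through it. *)
Lemma homotopic_row0 m k l (a b : 'M[R[i]]_(m, k)) (u : 'M[V]_m) :
  (m <= l)%N -> coisometry a -> coisometry b -> partial_unitary u ->
  homotopic (sand (row_mx a (0 : 'M[R[i]]_(m, l))) (row_mx a 0) u)
            (sand (row_mx b 0) (row_mx b 0) u).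
Proof.
move=> ml ca cb pu.
pose c : 'M[R[i]]_(m, k + l) := row_mx 0 (pid_mx m).
have cc : coisometry c by exact/coisometry_0row/coisometry_pid.
apply: (@homotopic_trans _ _ _ _ (sand c c u)); apply: homotopic_orth => //;
  rewrite ?adjmx_row ?mul_row_col ?adjmx0 ?mulmx0 ?mul0mx ?addr0 //;
  exact: coisometry_row0.
Qed.

Lemma simKP (u v : PUinf V) : simK u v <-> stable_homotopic u v.
Proof.
case: u v => m u m0 pu [n v n0 pv]; split=> [[k /= mnk h]|[k /= [a [b [ca cb h]]]]].
  have [mk nk] : (m <= k)%N /\ (n <= k)%N.
    by move: mnk; rewrite gtn_max => /andP[/ltnW -> /ltnW ->].
  exists k, (pid_mx m), (pid_mx n); rewrite -!padmxE //=.
  by split=> //; exact: coisometry_pid.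
(* [K] has room for the standard embeddings of both sizes and for the strict inequality in [simK];
   the last [N] columns are the free ones that [homotopic_row0] asks for. *)
pose K := (k + (m + n).+1)%N; pose N := (m + n)%N.
have [mN nN] : (m <= N)%N /\ (n <= N)%N by rewrite leq_addr leq_addl.
have NK : (N <= K)%N by rewrite /K addnS ltnW // ltnS leq_addl.
have [mK nK] := (leq_trans mN NK, leq_trans nN NK).
have pidE p : (p <= K)%N ->
    pid_mx p = row_mx (pid_mx p : 'M[R[i]]_(p, K)) (0 : 'M[R[i]]_(p, N)).
  move=> pK; have -> : row_mx (pid_mx p) 0 =
      (pid_mx p : 'M[R[i]]_(p, K)) *m row_mx 1%:M (0 : 'M[R[i]]_(K, N)).
    by rewrite mul_mx_row mulmx1 mulmx0.
  by rewrite -pid_mx_row mul_pid_mx (minn_idPl pK) (minn_idPr pK).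
have rowE p (c : 'M[R[i]]_(p, k)) :
    row_mx (row_mx c (0 : 'M[R[i]]_(p, (m + n).+1))) (0 : 'M[R[i]]_(p, N)) =
    c *m row_mx (row_mx 1%:M 0) 0.
  by rewrite !mul_mx_row mulmx1 !mulmx0.
exists (K + N)%N => /=.
  by rewrite gtn_max /K /N; apply/andP; split; lia.
have KN : (K <= K + N)%N := leq_addr _ _.
rewrite (padmxE u (leq_trans mK KN)) (padmxE v (leq_trans nK KN)).
rewrite (pidE m mK) (pidE n nK).
(* The padded [u] is moved to its conjugate by [a] extended by zeros, likewise [v] with [b]; the
   given homotopy, embedded in the larger size, joins the two. *)
have hu := homotopic_row0 mN (coisometry_pid R mK)
  (coisometry_row0 (m + n).+1 ca) pu.
have hv := homotopic_row0 nN (coisometry_pid R nK)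
  (coisometry_row0 (m + n).+1 cb) pv.
apply: (homotopic_trans hu); apply: homotopic_trans (homotopic_sym hv).
rewrite (rowE _ a) (rowE _ b) -!sand_sand; apply: homotopic_sand h.
by do 2 apply: coisometry_row0; exact: coisometry1.
Qed.

Lemma stable_homotopic_coisometry m k (a : 'M[R[i]]_(m, k)) (u : 'M[V]_m) :
  coisometry a -> partial_unitary u -> stable_homotopic u (sand a a u).
Proof.
move=> ca pu; exists k, a, 1%:M; rewrite sand1; split=> //.
  exact: coisometry1.
exact/homotopic_refl/partial_unitary_coisometry.
Qed.

Lemma stable_homotopic_refl m (u : 'M[V]_m) :
  partial_unitary u -> stable_homotopic u u.
Proof.
by move/(stable_homotopic_coisometry (coisometry1 R m)); rewrite sand1.
Qed.

Lemma stable_homotopic_sym m n (u : 'M[V]_m) (v : 'M[V]_n) :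
  stable_homotopic u v -> stable_homotopic v u.
Proof.
by move=> [k [a [b [ca cb h]]]]; exists k, b, a; split=> //; exact: homotopic_sym.
Qed.

(** The two homotopies live in sizes [k] and [l]. Placed on disjoint columns of size [k + l], they
    leave two copies of [v], conjugated by orthogonal coisometries and hence homotopic. *)
Lemma stable_homotopic_trans m n p (u : 'M[V]_m) (v : 'M[V]_n) (w : 'M[V]_p) :
  partial_unitary v ->
  stable_homotopic u v -> stable_homotopic v w -> stable_homotopic u w.
Proof.
move=> pv [k [a [b [ca cb h]]]] [l [c [d [cc cd h']]]].
have c1 := coisometry_row0 l (coisometry1 R k).
have c2 := coisometry_0row k (coisometry1 R l).
exists (k + l)%N, (row_mx a 0), (row_mx 0 d); split.
- exact: coisometry_row0.
- exact: coisometry_0row.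
have rowE q (x : 'M[R[i]]_(q, k)) :
    row_mx x (0 : 'M[R[i]]_(q, l)) = x *m row_mx 1%:M 0.
  by rewrite mul_mx_row mulmx1 mulmx0.
have rowE' q (x : 'M[R[i]]_(q, l)) :
    row_mx (0 : 'M[R[i]]_(q, k)) x = x *m row_mx 0 1%:M.
  by rewrite mul_mx_row mulmx1 mulmx0.
apply: (@homotopic_trans _ _ _ _ (sand (row_mx b 0) (row_mx b 0) v)).
  by rewrite (rowE _ a) (rowE _ b) -!sand_sand; exact: homotopic_sand.
apply: (@homotopic_trans _ _ _ _ (sand (row_mx 0 c) (row_mx 0 c) v)).
  apply: homotopic_orth => //; [exact: coisometry_row0|exact: coisometry_0row|].
  by rewrite adjmx_row mul_row_col adjmx0 mulmx0 mul0mx addr0.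
by rewrite (rowE' _ c) (rowE' _ d) -!sand_sand; exact: homotopic_sand.
Qed.

Lemma stable_homotopic_dsum m n p q (u : 'M[V]_m) (u' : 'M[V]_n)
    (v : 'M[V]_p) (v' : 'M[V]_q) :
  stable_homotopic u u' -> stable_homotopic v v' ->
  stable_homotopic (dsum u v) (dsum u' v').
Proof.
move=> [k [a [b [ca cb h]]]] [l [c [d [cc cd h']]]].
exists (k + l)%N, (block_mx a 0 0 c), (block_mx b 0 0 d).
split; [exact: coisometry_block|exact: coisometry_block|].
by rewrite /dsum !sand_block !sand0; exact: homotopic_dsum.
Qed.

(** The block swap is a scalar unitary that conjugates one sum into the other. *)
Lemma stable_homotopic_dsumC m n (u : 'M[V]_m) (v : 'M[V]_n) :
  partial_unitary u -> partial_unitary v ->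
  stable_homotopic (dsum u v) (dsum v u).
Proof.
move=> pu pv; pose s : 'M[R[i]]_(m + n, n + m) := block_mx 0 1%:M 1%:M 0.
have cs : coisometry s.
  rewrite /coisometry adjmx_block mulmx_block !adjmx0 !adjmx1.
  by rewrite !mulmx0 !mul0mx !mulmx1 !addr0 !add0r -scalar_mx_block.
have -> : dsum v u = sand s s (dsum u v).
  rewrite /dsum sand_col !sand0 !addr0 !sand_row !sand1.
  by rewrite !sand0l !sand0r add_block_mx !addr0 !add0r.
by apply: stable_homotopic_coisometry => //; exact: partial_unitary_dsum.
Qed.

(** Both sides are the same matrix up to a cast between [m + n + p] and [m + (n + p)]. *)
Lemma stable_homotopic_dsumA m n p (u : 'M[V]_m) (v : 'M[V]_n) (w : 'M[V]_p) :
  partial_unitary u -> partial_unitary v -> partial_unitary w ->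
  stable_homotopic (dsum (dsum u v) w) (dsum u (dsum v w)).
Proof.
move=> pu pv pw.
have puvw : partial_unitary (dsum (dsum u v) w).
  by do 2 apply: partial_unitary_dsum => //.
have castP k (e : (m + n + p = k)%N) :
    stable_homotopic (dsum (dsum u v) w) (castmx (e, e) (dsum (dsum u v) w)).
  by case: _ / e; rewrite castmx_id; exact: stable_homotopic_refl.
have := @block_mxAx _ m n p m n p u 0 0 0 v 0 0 0 w.
rewrite !row_mx0 !col_mx0 /dsum => ->; exact: castP.
Qed.

(** Serves the zero map, which sends partial unitaries of various sizes to zeros of those sizes. *)
Lemma stable_homotopic0 m n : stable_homotopic (0 : 'M[V]_m) (0 : 'M[V]_n).
Proof.
exists (m + n)%N, (row_mx 1%:M 0), (row_mx 0 1%:M); rewrite !sand0; split.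
- exact/coisometry_row0/coisometry1.
- exact/coisometry_0row/coisometry1.
- exact/homotopic_refl/partial_unitary0.
Qed.

End StableEquivalence.

(** * Unital completely absolute-value-preserving maps respect stable homotopy *)

Section StableMorphism.
Variables (R : realType) (V W : absMatrixOrderUnitType R).
Variables (phi : {linear V -> W}).
Hypotheses (phi1 : unital phi) (phia : completely_abs_preserving phi).

(** A positive [v] equals [|v|], so its image is the absolute value of [phi v]. *)
Lemma map_mxpos n (v : 'M[V]_n) : mxpos n v -> mxpos n (map_mx phi v).
Proof. by move=> v0; rewrite -(mxabs_id v0) -phia.2; exact: mxabs_pos. Qed.

Lemma map_rscaleV m n k (v : 'M[V]_(m, n)) :
  map_mx phi (rscaleV k v) = rscaleV k (map_mx phi v).
Proof. by apply/matrixP=> i j; rewrite !mxE linearZ. Qed.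

(** Contractivity: positivity at size [n + n], unitality and compatibility with the involution carry
    the block matrix of [v] to that of its image. *)
Lemma map_normb n k (v : 'M[V]_n) : normb k v -> normb k (map_mx phi v).
Proof.
move=> /map_mxpos; rewrite map_block_mx map_rscaleV /normb.
have -> : map_mx phi ounit%:M = ounit%:M :> 'M[W]_n.
  by apply/matrixP=> i j; rewrite !mxE raddfMn /= (phi1 : phi ounit = ounit).
suff -> : map_mx phi (starmx v) = starmx (map_mx phi v) by [].
by apply/matrixP=> i j; rewrite !mxE phia.1.
Qed.

Lemma homotopic_map n (u v : 'M[V]_n) :
  homotopic u v -> homotopic (map_mx phi u) (map_mx phi v).
Proof.
move=> /homotopicP[f [pf cf f0 f1]]; apply/homotopicP.
exists (fun t => map_mx phi (f t)); rewrite f0 f1; split=> //.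
- by move=> t /pf; exact: partial_unitary_map.
- move=> t t01 e e0; have [d d0 h] := cf t t01 e e0; exists d => // s s01 st.
  by rewrite -raddfB; apply: map_normb; exact: h.
Qed.

Lemma stable_homotopic_map m n (u : 'M[V]_m) (v : 'M[V]_n) :
  stable_homotopic u v -> stable_homotopic (map_mx phi u) (map_mx phi v).
Proof.
move=> [k [a [b [ca cb h]]]]; exists k, a, b; split=> //.
by have := homotopic_map h; rewrite !sand_map.
Qed.

End StableMorphism.

(** * The Grothendieck group construction *)

Section KTheory.
Variables (R : realType) (V : absMatrixOrderUnitType R).
Implicit Types (u v w x y : PUinf V) (p q r : PUinf V * PUinf V).

Lemma simK_refl u : simK u u.
Proof. exact/simKP/stable_homotopic_refl/pu_mxP. Qed.

Lemma simK_sym u v : simK u v -> simK v u.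
Proof. by move=> /simKP h; apply/simKP/stable_homotopic_sym. Qed.

Lemma simK_trans u v w : simK u v -> simK v w -> simK u w.
Proof.
move=> /simKP uv /simKP vw; apply/simKP.
exact: stable_homotopic_trans (pu_mxP v) uv vw.
Qed.

Lemma simK_sum u v x y : simK u v -> simK x y -> simK (PUsum u x) (PUsum v y).
Proof. by move=> /simKP h /simKP h'; apply/simKP/stable_homotopic_dsum. Qed.

Lemma simK_sumC u v : simK (PUsum u v) (PUsum v u).
Proof. apply/simKP/stable_homotopic_dsumC; exact: pu_mxP. Qed.

Lemma simK_sumA u v w : simK (PUsum (PUsum u v) w) (PUsum u (PUsum v w)).
Proof. apply/simKP/stable_homotopic_dsumA; exact: pu_mxP. Qed.

Lemma simK_sumAC u v w : simK (PUsum (PUsum u v) w) (PUsum (PUsum u w) v).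
Proof.
apply: (simK_trans (simK_sumA _ _ _)).
apply: simK_trans (simK_sym (simK_sumA _ _ _)).
by apply: simK_sum; [exact: simK_refl|exact: simK_sumC].
Qed.

Lemma simK_sumACA u v x y :
  simK (PUsum (PUsum u v) (PUsum x y)) (PUsum (PUsum u x) (PUsum v y)).
Proof.
apply: (simK_trans (simK_sym (simK_sumA _ _ _))).
apply: simK_trans (simK_sumA _ _ _).
by apply: simK_sum; [exact: simK_sumAC|exact: simK_refl].
Qed.

Lemma simK_approx u v : simK u v -> approxK u v.
Proof. by move=> uv; exists u; apply: simK_sum => //; exact: simK_refl. Qed.

Lemma approxK_sym u v : approxK u v -> approxK v u.
Proof. by move=> [w h]; exists w; exact: simK_sym. Qed.

(** The sum of the two auxiliary summands stabilises both relations at once. *)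
Lemma approxK_trans u v w : approxK u v -> approxK v w -> approxK u w.
Proof.
move=> [x h] [y h']; exists (PUsum x y).
apply: (simK_trans (simK_sym (simK_sumA _ _ _))).
apply: (simK_trans (simK_sum h (simK_refl y))).
apply: (simK_trans (simK_sumAC _ _ _)).
apply: (simK_trans (simK_sum h' (simK_refl x))).
apply: (simK_trans (simK_sumAC _ _ _)); exact: simK_sumA.
Qed.

Lemma approxK_sum u v x y :
  approxK u v -> approxK x y -> approxK (PUsum u x) (PUsum v y).
Proof.
move=> [w h] [z h']; exists (PUsum w z).
apply: (simK_trans (simK_sumACA _ _ _ _)).
by apply: simK_trans (simK_sumACA _ _ _ _); exact: simK_sum.
Qed.

(** The common summand is absorbed into the auxiliary one. *)
Lemma approxK_cancel u v w : approxK (PUsum u w) (PUsum v w) -> approxK u v.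
Proof.
move=> [z h]; exists (PUsum w z).
apply: (simK_trans (simK_sym (simK_sumA _ _ _))).
exact: simK_trans (simK_sumA _ _ _).
Qed.

Lemma equivK_sym p q : equivK p q -> equivK q p.
Proof. exact: approxK_sym. Qed.

(** Adding the two hypotheses and rearranging gives the wanted relation with [q.2] and [q.1] added
    on both sides; these cancel. *)
Lemma equivK_trans p q r : equivK p q -> equivK q r -> equivK p r.
Proof.
move=> pq qr; apply: (@approxK_cancel _ _ (PUsum q.2 q.1)).
have C u v := simK_approx (simK_sumC u v).
have ACA u v x y := simK_approx (simK_sumACA u v x y).
apply: (approxK_trans (ACA _ _ _ _)).
apply: (approxK_trans (approxK_sum pq (approxK_trans (C _ _) qr))).
apply: (approxK_trans (C _ _)).
apply: approxK_trans (approxK_sym (ACA _ _ _ _)).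
by apply: approxK_sum => //; exact/simK_approx/simK_refl.
Qed.

Lemma equivK_sum p q p' q' : equivK p q -> equivK p' q' ->
  equivK (PUsum p.1 p'.1, PUsum p.2 p'.2) (PUsum q.1 q'.1, PUsum q.2 q'.2).
Proof.
move=> pq pq'; have ACA u v x y := simK_approx (simK_sumACA u v x y).
apply: (approxK_trans (ACA _ _ _ _)); apply: approxK_trans (ACA _ _ _ _).
exact: approxK_sum.
Qed.

Lemma Kcl_eq p q : equivK p q -> Kcl p = Kcl q.
Proof.
move=> pq; apply: val_inj; apply/seteqP; split=> r.
  exact/equivK_trans/equivK_sym.
exact: equivK_trans.
Qed.

Lemma Kcl_equiv p q : Kcl p = Kcl q -> equivK p q.
Proof.
move=> /(congr1 val) /= pq; suff : Kclass p q by [].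
by rewrite pq; exact/simK_approx/simK_refl.
Qed.

Lemma Krepr_equiv p : equivK (Krepr (Kcl p)) p.
Proof. exact/Kcl_equiv/(projT2 (cid (Kcl_surj (Kcl p)))). Qed.

Lemma Kadd_cl p q : Kadd (Kcl p) (Kcl q) = Kcl (PUsum p.1 q.1, PUsum p.2 q.2).
Proof. by apply: Kcl_eq; apply: equivK_sum; exact: Krepr_equiv. Qed.

(** Stated for [simK]-related entries rather than equal ones, since two zero matrices may differ in
    size. *)
Lemma Kcl_diag u v : simK u v -> Kcl (u, v) = Kzero V.
Proof.
move=> uv; apply: Kcl_eq; apply: simK_approx => /=.
apply: (simK_trans (simK_sumC _ _)).
by apply: simK_sum => //; exact: simK_refl.
Qed.

Lemma PUinf_eq n (u v : 'M[V]_n) (n1 n2 : (0 < n)%N)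
    (pu : partial_unitary u) (pv : partial_unitary v) :
  u = v -> MkPU n1 pu = MkPU n2 pv.
Proof.
by move=> uv; case: _ / uv pv => pv; congr MkPU; exact: Prop_irrelevance.
Qed.

End KTheory.

(** * Existence of the induced homomorphism [K(phi)] *)

Section KMorphism.
Variables (R : realType) (V W : absMatrixOrderUnitType R).
Variables (phi : {linear V -> W}).
Hypotheses (phi1 : unital phi) (phia : completely_abs_preserving phi).

Lemma PUmap_sum (u v : PUinf V) :
  PUmap phi (PUsum u v) = PUsum (PUmap phi u) (PUmap phi v).
Proof.
rewrite !(PUmap_unitalE _ phi1 phia); apply: PUinf_eq => /=.
by rewrite map_block_mx !raddf0.
Qed.

Lemma simK_map (u v : PUinf V) :
  simK u v -> simK (PUmap phi u) (PUmap phi v).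
Proof.
move=> /simKP h; rewrite !(PUmap_unitalE _ phi1 phia); apply/simKP.
exact: stable_homotopic_map.
Qed.

Lemma equivK_map (p q : PUinf V * PUinf V) : equivK p q ->
  equivK (PUmap phi p.1, PUmap phi p.2) (PUmap phi q.1, PUmap phi q.2).
Proof.
by move=> [w h]; exists (PUmap phi w); rewrite -!PUmap_sum; exact: simK_map.
Qed.

(** The map is defined on chosen representatives; [equivK_map] makes the formula hold for every
    representative, and additivity follows from it. *)
Lemma is_Kmap_exists : exists h, is_Kmap phi h.
Proof.
pose h (x : K V) : K W :=
  Kcl (PUmap phi (Krepr x).1, PUmap phi (Krepr x).2).
have hE p : h (Kcl p) = Kcl (PUmap phi p.1, PUmap phi p.2).
  by apply: Kcl_eq; apply: equivK_map; exact: Krepr_equiv.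
exists h; split=> [x y|v w]; last exact: hE.
have [p <-] := Kcl_surj x; have [q <-] := Kcl_surj y.
by rewrite Kadd_cl !hE Kadd_cl !PUmap_sum.
Qed.

Lemma Kmap_is_Kmap : is_Kmap phi (Kmap phi).
Proof. by have [h hK] := is_Kmap_exists; rewrite (KmapP hK). Qed.

End KMorphism.

(** * Functoriality of [K] and its value on the zero map *)

Unset Implicit Arguments.
Set Strict Implicit.
Set Printing Implicit Defensive.

Theorem corollary4p19 (R : realType) (U V W : absMatrixOrderUnitType R)
    (phi : {linear U -> V}) (psi : {linear V -> W})
    (phi_unital : unital phi) (phi_abs : completely_abs_preserving phi)
    (psi_unital : unital psi) (psi_abs : completely_abs_preserving psi) :
  [/\ Kmap (fun x : V => x) = (fun x : K V => x),
      Kmap (fun x : U => psi (phi x)) = (fun x : K U => Kmap psi (Kmap phi x))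
    & Kmap (fun _ : V => 0 : W) = (fun _ : K V => Kzero W)].
Proof.
(* By uniqueness it suffices that each right-hand side is additive and obeys the formula on
   classes. *)
split; apply: KmapP; split=> //.
- have PUmap_id v : PUmap (fun x : V => x) v = v.
    rewrite /PUmap; have idE : map_mx (fun x : V => x) v = v.
      by apply/matrixP=> i j; rewrite mxE.
    case: pselect => [pv|]; last by rewrite idE; case; exact: pu_mxP.
    by case: v idE pv => n v n0 pv idE piv; exact: PUinf_eq.
  by move=> v w; rewrite !PUmap_id.
- have [phiD _] := Kmap_is_Kmap phi_unital phi_abs.
  have [psiD _] := Kmap_is_Kmap psi_unital psi_abs.
  by move=> x y; rewrite phiD psiD.
- have PUmap_comp u :
      PUmap (fun x : U => psi (phi x)) u = PUmap psi (PUmap phi u).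
    rewrite (PUmap_unitalE u phi_unital phi_abs) PUmap_unitalE {1}/PUmap.
    have compE : map_mx (fun x : U => psi (phi x)) u = map_mx psi (map_mx phi u).
      by apply/matrixP=> i j; rewrite !mxE.
    case: pselect => [pu|]; first exact: PUinf_eq.
    by case; rewrite compE; do 2 apply: partial_unitary_map => //; exact: pu_mxP.
  move=> v w; rewrite (Kmap_is_Kmap phi_unital phi_abs).2.
  by rewrite (Kmap_is_Kmap psi_unital psi_abs).2 !PUmap_comp.
(* The sum of two copies of the zero class is represented by a pair with equal entries, hence is
   zero. *)
- move=> x y; rewrite Kadd_cl; apply/esym/Kcl_diag; exact: simK_refl.
- move=> v w; apply/esym/Kcl_diag; rewrite !PUmap_zeroE; apply/simKP => /=.
  have mapE n (u : 'M[V]_n) : map_mx (fun _ : V => 0 : W) u = 0.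
    by apply/matrixP=> i j; rewrite !mxE.
  by rewrite !mapE; exact: stable_homotopic0.
Qed.
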